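(* Let $n\ge3$. The generating function of fully commutative elements of type $\widetilde{A}_{n-1}$ is $$\widetilde{A}^{FC}_{n-1}(q)=O^*_n(q)-\frac{2q^n}{1-q^n}=\frac{q^n(\check O_n(q)-2)}{1-q^n}+\check O^*_n(q).$$ Moreover it can be computed through the equations $$\check O(x)=M(x)\left(1+qx^2\,\frac{\partial(xM)}{\partial x}(qx)\right),\qquad \check O^*(x)=M^*(x)\left(1+qx^2\,\frac{\partial(xM)}{\partial x}(qx)\right),$$ where $M(x)$ and $M^*(x)$ are determined by $$M^*(x)=1+xM^*(x)+qx(M^*(x)-1)M^*(qx),\qquad M(x)=M^*(x)+xM^*(x)M(x).$$
   Context: Type $\widetilde{A}_{n-1}$: generators $s_0,\dots,s_{n-1}$, $m_{s_is_{i+1}}=3$ (indices mod $n$), other pairs of distinct generators commute. An element is fully commutative (FC) if any of its reduced expressions can be obtained from any other one using only commutation relations. $\widetilde{A}^{FC}_{n-1}(q)=\sum_w q^{\ell(w)}$ over FC elements $w$, $\ell$ the Coxeter length. A walk of length $n$ is a sequence $P=(P_0,\dots,P_n)$ of points $P_i=(i,h_i)\in\mathbb{N}^2$ with steps in $\{(1,1),(1,-1),(1,0)\}$, each horizontal step being labeled $L$ or $R$. Condition $( * )$: all horizontal steps at height $0$ are labeled $L$. A superscript $*$ on a family means restriction to walks satisfying $( * )$; a check $\check{\ }$ means restriction to walks that hit the $x$-axis at some point. $\mathcal{M}_n$: walks of length $n$ from $(0,0)$ to $(n,0)$; $M_n(q)=\sum_{P\in\mathcal{M}_n}q^{\sum_{i=0}^n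 h_i}$, similarly $M^*_n(q)$ over $\mathcal{M}^*_n$; $M(x)=\sum_{n\ge0}M_n(q)x^n$, $M^*(x)=\sum_{n\ge0}M_n^*(q)x^n$. $\mathcal{O}_n$: walks of length $n$ whose starting and ending points are at the same height; $O_n(q)$, $O^*_n(q)$, $\check O_n(q)$, $\check O^*_n(q)$ are the generating functions $\sum_P q^{\operatorname{ht}'(P)}$ of $\mathcal{O}_n,\mathcal{O}^*_n,\check{\mathcal{O}}_n,\check{\mathcal{O}}^*_n$, where $\operatorname{ht}'(P)=\sum_{i=0}^{n-1}h_i$; $\check O(x)=\sum_{n\ge0}\check O_n(q)x^n$, $\check O^*(x)=\sum_{n\ge0}\check O^*_n(q)x^n$ (the empty walk counts for $n=0$, i.e. $\check O_0=\check O_0^*=1$). $\frac{\partial(xM)}{\partial x}(qx)$ denotes the series $\frac{\partial}{\partial x}(xM(x))$ with $x$ replaced by $qx$. *)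

(* Defs.v *)
From HB Require Import structures.
From mathcomp Require Import all_boot all_order all_algebra.
From mathcomp Require Import generic_quotient finmap.
From mathcomp Require Import boolp classical_sets functions cardinality.

Set Implicit Arguments.
Unset Strict Implicit.
Unset Printing Implicit Defensive.

Import GRing.Theory.
Local Open Scope ring_scope.

(* A record rather than a plain function type, so that the convolution product
   does not clash with the pointwise ring structure on functions. *)
Record fps (R : Type) := FPS { coefs : nat -> R }.

Lemma fpsP (R : Type) (f g : fps R) :
  (forall n, coefs f n = coefs g n) -> f = g.
Proof. by case: f g => [f] [g] /= fg; congr FPS; apply/funext. Qed.

HB.instance Definition _ (R : Type) := gen_eqMixin (fps R).
HB.instance Definition _ (R : Type) := gen_choiceMixin (fps R).

Section Zmodule.
Variable R : zmodType.
Implicit Types f g h : fps R.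

Definition fps_zero : fps R := FPS (fun=> 0).
Definition fps_opp f := FPS (fun n => - coefs f n).
Definition fps_add f g := FPS (fun n => coefs f n + coefs g n).

Fact fps_addA : associative fps_add.
Proof. by move=> f g h; apply: fpsP => n /=; rewrite addrA. Qed.
Fact fps_addC : commutative fps_add.
Proof. by move=> f g; apply: fpsP => n /=; rewrite addrC. Qed.
Fact fps_add0 : left_id fps_zero fps_add.
Proof. by move=> f; apply: fpsP => n /=; rewrite add0r. Qed.
Fact fps_addN : left_inverse fps_zero fps_opp fps_add.
Proof. by move=> f; apply: fpsP => n /=; rewrite addNr. Qed.

HB.instance Definition _ :=
  GRing.isZmodule.Build (fps R) fps_addA fps_addC fps_add0 fps_addN.
End Zmodule.

Section Ring.
Variable R : comNzRingType.
Implicit Types f g h : fps R.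

Definition fps_one : fps R := FPS (fun n => (n == 0%N)%:R).
Definition fps_mul f g :=
  FPS (fun n => \sum_(i < n.+1) coefs f i * coefs g (n - i)).

Let tr n f : {poly R} := \poly_(i < n.+1) coefs f i.

Let tr_mul n k f g : (k <= n)%N ->
  coefs (fps_mul f g) k = (tr n f * tr n g)`_k.
Proof.
move=> kn; rewrite coefM; apply: eq_bigr => i _.
have ik : (i <= k)%N by rewrite -ltnS.
by rewrite !coef_poly !ltnS (leq_trans ik kn) (leq_trans (leq_subr i k) kn).
Qed.

Let trE n f k : (k <= n)%N -> (tr n f)`_k = coefs f k.
Proof. by move=> kn; rewrite coef_poly ltnS kn. Qed.

Fact fps_mulC : commutative fps_mul.
Proof.
by move=> f g; apply: fpsP => n; rewrite !(@tr_mul n n) // mulrC.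
Qed.
Fact fps_mulA : associative fps_mul.
Proof.
move=> f g h; apply: fpsP => n.
rewrite !(@tr_mul n n) //.
transitivity ((tr n f * (tr n g * tr n h))`_n).
  rewrite !coefM; apply: eq_bigr => i _; congr (_ * _).
  by rewrite trE ?leq_subr // (@tr_mul n) ?leq_subr.
rewrite mulrA !coefM; apply: eq_bigr => i _; congr (_ * _).
have le_in : (i <= n)%N by rewrite -ltnS.
by rewrite trE // (@tr_mul n).
Qed.
Fact fps_mul1 : left_id fps_one fps_mul.
Proof.
move=> f; apply: fpsP => n /=.
rewrite big_ord_recl /= mul1r subn0 big1 ?addr0 // => i _.
by rewrite mul0r.
Qed.
Fact fps_mulDl : left_distributive fps_mul +%R.
Proof.
move=> f g h; apply: fpsP => n /=; rewrite -big_split /=.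
by apply: eq_bigr => i _; rewrite mulrDl.
Qed.
Fact fps_one_neq0 : fps_one != 0.
Proof.
apply/eqP => /(congr1 (fun f => coefs f 0)) /= /eqP.
by rewrite oner_eq0.
Qed.

HB.instance Definition _ := GRing.Zmodule_isComNzRing.Build (fps R)
  fps_mulA fps_mulC fps_mul1 fps_mulDl fps_one_neq0.

Definition fpsC (a : R) : fps R := FPS (fun n => if n is 0%N then a else 0).
Definition fpsX : fps R := FPS (fun n => (n == 1%N)%:R).
Definition fps_deriv f : fps R := FPS (fun n => coefs f n.+1 *+ n.+1).

(* The series f(a x). *)
Definition fps_dilate (a : R) f : fps R := FPS (fun n => a ^+ n * coefs f n).
End Ring.

Arguments fpsX {R}.

Section UnitRing.
Variable R : comUnitRingType.
Implicit Types f g : fps R.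

Definition fps_unit : {pred fps R} := fun f => coefs f 0 \is a GRing.unit.

(* The list of the first n coefficients of f^-1, last one first. *)
Fixpoint fps_inv_coefs f n : seq R :=
  if n is n'.+1 then
    let s := fps_inv_coefs f n' in
    (if n' is 0%N then (coefs f 0)^-1
     else - (coefs f 0)^-1 * \sum_(i < n') coefs f i.+1 * s`_i) :: s
  else [::].

Definition fps_inv f : fps R :=
  if f \in fps_unit then FPS (fun n => (fps_inv_coefs f n.+1)`_0) else f.

Let nth_inv_coefs f n i : (i < n)%N ->
  (fps_inv_coefs f n)`_i = (fps_inv_coefs f (n - i))`_0.
Proof.
elim: n i => // n IHn [|i] lt_in //.
by rewrite subSS -IHn.
Qed.

Fact fps_mulVf : {in fps_unit, left_inverse 1 fps_inv *%R}.
Proof.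
move=> f Uf; rewrite mulrC; apply: fpsP => n.
rewrite /fps_inv Uf; case: n => [|n].
  by rewrite /= big_ord1 /= divrr.
rewrite [LHS]/= big_ord_recl subn0.
rewrite [X in _ * X + _]/= mulrA mulrN divrr // mulN1r.
rewrite addrC; apply/eqP; rewrite subr_eq0; apply/eqP.
apply: eq_bigr => i _.
rewrite lift0 subSS; congr (_ * _).
have le_in : (i <= n)%N by rewrite -ltnS.
rewrite -[RHS]/((fps_inv_coefs f n.+1)`_i) nth_inv_coefs // subSn //.
Qed.

Fact fps_unitPl f g : g * f = 1 -> fps_unit f.
Proof.
move=> /(congr1 (fun h => coefs h 0)) /=; rewrite big_ord1 /= => gf1.
by apply/unitrPr; exists (coefs g 0); rewrite mulrC.
Qed.
Fact fps_inv_out : {in [predC fps_unit], fps_inv =1 id}.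
Proof. by move=> f; rewrite /fps_inv => /negbTE; case: (f \in fps_unit). Qed.

HB.instance Definition _ := GRing.ComNzRing_hasMulInverse.Build (fps R)
  fps_mulVf fps_unitPl fps_inv_out.
End UnitRing.

Local Open Scope fset_scope.
Local Open Scope classical_set_scope.

(* The sum of q ^ (wt a) over a in A; meaningful when each fiber
   [set a in A | wt a = k] is finite (fset_set B is empty for B infinite). *)
Definition genfun (T : choiceType) (A : set T) (wt : T -> nat) : fps int :=
  FPS (fun k => (#|` fset_set [set a | A a /\ wt a = k]|)%:R).

(* The value 0 encodes an infinite entry. *)
Record coxeter_matrix (S : finType) := CoxeterMatrix {
  cox_m :> S -> S -> nat;
  cox_m_diag : forall s t, (cox_m s t == 1%N) = (s == t);
  cox_m_sym : forall s t, cox_m s t = cox_m t s }.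

Section Coxeter.
Variables (S : finType) (m : coxeter_matrix S).
Implicit Types u v w : seq S.

(* The congruence on words generated by (s t)^(m s t) = 1; since m s s = 1,
   each generator is its own inverse, so words in the s need no formal
   inverses. *)
Inductive cox_eq : seq S -> seq S -> Prop :=
| CoxRefl u : cox_eq u u
| CoxSym u v : cox_eq u v -> cox_eq v u
| CoxTrans v u w : cox_eq u v -> cox_eq v w -> cox_eq u w
| CoxRel u v s t :
    cox_eq (u ++ flatten (nseq (m s t) [:: s; t]) ++ v) (u ++ v).

Definition cox_eqb u v := `[< cox_eq u v >].

Fact cox_eqb_refl : reflexive cox_eqb.
Proof. by move=> u; apply/asboolP; exact: CoxRefl. Qed.
Fact cox_eqb_sym : symmetric cox_eqb.
Proof. by move=> u v; apply/asboolP/asboolP => /CoxSym. Qed.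
Fact cox_eqb_trans : transitive cox_eqb.
Proof.
by move=> v u w /asboolP uv /asboolP vw; apply/asboolP; exact: CoxTrans vw.
Qed.

Canonical cox_equiv := EquivRel cox_eqb cox_eqb_refl cox_eqb_sym cox_eqb_trans.

Definition coxeter_group := {eq_quot cox_equiv}%qT.
HB.instance Definition _ := Choice.on coxeter_group.
HB.instance Definition _ := EqQuotient.on coxeter_group.

Definition cox_class u : coxeter_group := (\pi_coxeter_group u)%qT.
Definition cox_mul (g h : coxeter_group) : coxeter_group :=
  cox_class (repr g ++ repr h).
Definition cox_inv (g : coxeter_group) : coxeter_group :=
  cox_class (rev (repr g)).

Fact cox_classP u v : cox_class u = cox_class v <-> cox_eq u v.
Proof.
split=> [/eqP|uv].
  by rewrite /cox_class piE => /asboolP.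
by apply/eqP; rewrite /cox_class piE; apply/asboolP.
Qed.

Fact cox_class_repr (g : coxeter_group) : cox_class (repr g) = g.
Proof. exact: reprK. Qed.

Fact cox_eq_cat u u' v v' : cox_eq u u' -> cox_eq v v' ->
  cox_eq (u ++ v) (u' ++ v').
Proof.
move=> uu' vv'; apply: (@CoxTrans (u' ++ v)).
  elim: uu' => {u u'}.
  - by move=> u; exact: CoxRefl.
  - by move=> u w _ /CoxSym.
  - by move=> x u w _ h _; exact: CoxTrans.
  - by move=> u w s t; rewrite -!catA; exact: CoxRel.
elim: vv' => {v v'}.
- by move=> v; exact: CoxRefl.
- by move=> v w _ /CoxSym.
- by move=> x v w _ h _; exact: CoxTrans.
- by move=> v w s t; rewrite !catA -!(catA (u' ++ v)); exact: CoxRel.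
Qed.

Fact cox_eq_rev u v : cox_eq u v -> cox_eq (rev u) (rev v).
Proof.
elim=> {u v}.
- by move=> u; exact: CoxRefl.
- by move=> u w _ /CoxSym.
- by move=> x u w _ h _; exact: CoxTrans.
- move=> u v s t; rewrite !rev_cat -catA.
  suff -> : rev (flatten (nseq (m s t) [:: s; t]))
      = flatten (nseq (m t s) [:: t; s]) by exact: CoxRel.
  rewrite cox_m_sym; elim: (m t s) => // k IHk.
  rewrite -addn1 [in LHS]addn1 nseqD flatten_cat /= -IHk.
  by rewrite -[s :: t :: _]/([:: s; t] ++ _) rev_cat.
Qed.

Fact cox_eq_revl u : cox_eq (rev u ++ u) [::].
Proof.
elim: u => [|s u IHu]; first exact: CoxRefl.
apply: CoxTrans IHu; rewrite rev_cons cat_rcons.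
have mss : m s s = 1%N by apply/eqP; rewrite cox_m_diag.
by have := CoxRel (rev u) u s s; rewrite mss.
Qed.

Fact cox_class_cat u v : cox_class (u ++ v) = cox_mul (cox_class u) (cox_class v).
Proof.
by apply/cox_classP; apply: cox_eq_cat; apply/cox_classP;
  rewrite cox_class_repr.
Qed.

Fact cox_class_rev u : cox_class (rev u) = cox_inv (cox_class u).
Proof.
by apply/cox_classP; apply: cox_eq_rev; apply/cox_classP;
  rewrite cox_class_repr.
Qed.

Fact cox_mulA : associative cox_mul.
Proof.
move=> f g h.
rewrite -[f]cox_class_repr -[g]cox_class_repr -[h]cox_class_repr.
by rewrite -!cox_class_cat catA.
Qed.
Fact cox_mul1 : left_id (cox_class [::]) cox_mul.
Proof. by move=> f; rewrite -[f]cox_class_repr -cox_class_cat. Qed.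
Fact cox_mulr1 : right_id (cox_class [::]) cox_mul.
Proof. by move=> f; rewrite -[f]cox_class_repr -cox_class_cat cats0. Qed.
Fact cox_mulV : left_inverse (cox_class [::]) cox_inv cox_mul.
Proof.
move=> f; rewrite -[f]cox_class_repr -cox_class_rev -cox_class_cat.
by apply/cox_classP; exact: cox_eq_revl.
Qed.
Fact cox_mulrV : right_inverse (cox_class [::]) cox_inv cox_mul.
Proof.
move=> f; rewrite -[f]cox_class_repr -cox_class_rev -cox_class_cat.
apply/cox_classP; rewrite -[X in cox_eq (X ++ _)]revK.
exact: cox_eq_revl.
Qed.

HB.instance Definition _ := isGroup.Build coxeter_group
  cox_mulA cox_mul1 cox_mulr1 cox_mulV cox_mulrV.

Definition cox_gen (s : S) : coxeter_group := cox_class [:: s].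

Definition expression (w : seq S) (g : coxeter_group) : Prop :=
  (\prod_(s <- w) cox_gen s)%g = g.

Lemma prod_cox_gen w : (\prod_(s <- w) cox_gen s)%g = cox_class w.
Proof.
elim: w => [|s w IHw]; first by rewrite big_nil.
by rewrite big_cons IHw -[s :: w]cat1s cox_class_cat.
Qed.

Fact cox_length_subproof (g : coxeter_group) :
  exists l, `[< exists2 w, expression w g & size w = l >].
Proof.
exists (size (repr g)); apply/asboolP; exists (repr g) => //.
by rewrite /expression prod_cox_gen cox_class_repr.
Qed.

Definition cox_length (g : coxeter_group) : nat :=
  ex_minn (cox_length_subproof g).

Definition reduced_expression w (g : coxeter_group) : Prop :=
  expression w g /\ size w = cox_length g.

(* Commutation relations are s t = t s for m s t = 2. *)
Inductive commutation_eq : seq S -> seq S -> Prop :=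
| CommRefl u : commutation_eq u u
| CommStep u v s t w : m s t = 2%N ->
    commutation_eq (u ++ [:: t; s] ++ v) w ->
    commutation_eq (u ++ [:: s; t] ++ v) w.

Definition fully_commutative (g : coxeter_group) : Prop :=
  forall w w', reduced_expression w g -> reduced_expression w' g ->
    commutation_eq w w'.

Lemma finite_cox_length (k : nat) :
  finite_set [set g : coxeter_group | cox_length g = k].
Proof.
apply: (@sub_finite_set _ _ ((fun t : k.-tuple S => cox_class t) @` setT)).
  move=> g /= <-; rewrite /cox_length; case: ex_minnP => l /asboolP[w wg <-] _.
  by exists (in_tuple w); rewrite //= -prod_cox_gen.
exact/finite_image/finite_finset.
Qed.
End Coxeter.

Definition affineA_m (n : nat) (i j : 'I_n) : nat :=
  if i == j then 1%N
  else if (j == ordS i) || (i == ordS j) then 3%N else 2%N.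

Fact affineA_m_diag n (i j : 'I_n) : (affineA_m i j == 1%N) = (i == j).
Proof. by rewrite /affineA_m; case: ifP => // _; case: ifP. Qed.
Fact affineA_m_sym n (i j : 'I_n) : affineA_m i j = affineA_m j i.
Proof. by rewrite /affineA_m eq_sym orbC. Qed.

(* The Coxeter matrix of the affine type A with n generators, for n >= 3. *)
Definition affineA (n : nat) : coxeter_matrix 'I_n :=
  CoxeterMatrix (@affineA_m_diag n) (@affineA_m_sym n).

Definition affineA_FC (n : nat) : fps int :=
  genfun [set w : coxeter_group (affineA n) | fully_commutative w]
         (@cox_length _ (affineA n)).

Inductive step := Up | Down | FlatL | FlatR.

Definition bools_of_step (s : step) : bool * bool :=
  match s with
  | Up => (true, true) | Down => (true, false)
  | FlatL => (false, true) | FlatR => (false, false)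
  end.
Definition step_of_bools (b : bool * bool) : step :=
  match b with
  | (true, true) => Up | (true, false) => Down
  | (false, true) => FlatL | (false, false) => FlatR
  end.
Fact bools_of_stepK : cancel bools_of_step step_of_bools.
Proof. by case. Qed.
HB.instance Definition _ := Finite.copy step (can_type bools_of_stepK).

(* The heights h_0, ..., h_n and the labeled steps of a walk of length n. *)
Definition prewalk (n : nat) := (n.+1.-tuple nat * n.-tuple step)%type.

Section Walks.
Variable n : nat.
Implicit Types P : prewalk n.

Definition height P (i : nat) : nat := nth 0%N P.1 i.

Definition is_step (a : nat) (s : step) (b : nat) : bool :=
  match s with
  | Up => b == a.+1
  | Down => a == b.+1
  | FlatL | FlatR => b == a
  end.

Definition is_walk P : Prop :=
  forall i : 'I_n, is_step (height P i) (tnth P.2 i) (height P i.+1).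

Definition cond_star P : Prop :=
  forall i : 'I_n, height P i = 0%N -> tnth P.2 i <> FlatR.

Definition hits_axis P : Prop := exists i : 'I_n.+1, height P i = 0%N.

Definition walkM : set (prewalk n) :=
  [set P | [/\ is_walk P, height P 0 = 0%N & height P n = 0%N]].
Definition walkMstar : set (prewalk n) := walkM `&` [set P | cond_star P].

Definition walkO : set (prewalk n) :=
  [set P | is_walk P /\ height P 0 = height P n].
Definition walkOstar : set (prewalk n) := walkO `&` [set P | cond_star P].
Definition walkOcheck : set (prewalk n) := walkO `&` [set P | hits_axis P].
Definition walkOcheckstar : set (prewalk n) :=
  walkOstar `&` [set P | hits_axis P].

Definition wtM P : nat := \sum_(i < n.+1) height P i.
Definition wtO P : nat := \sum_(i < n) height P i.
End Walks.

Definition M_ n : fps int := genfun (@walkM n) (@wtM n).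
Definition Mstar_ n : fps int := genfun (@walkMstar n) (@wtM n).
Definition Ostar_ n : fps int := genfun (@walkOstar n) (@wtO n).
Definition Ocheck_ n : fps int := genfun (@walkOcheck n) (@wtO n).
Definition Ocheckstar_ n : fps int := genfun (@walkOcheckstar n) (@wtO n).

(* fps (fps int): series in x whose coefficients are series in q. *)
Definition M_gf : fps (fps int) := FPS M_.
Definition Mstar_gf : fps (fps int) := FPS Mstar_.
Definition Ocheck_gf : fps (fps int) := FPS Ocheck_.
Definition Ocheckstar_gf : fps (fps int) := FPS Ocheckstar_.

(* The finiteness that makes genfun meaningful on walks; the family walkO 0
   is the exception, and is not used. *)
Section Finiteness.
Variable n : nat.
Implicit Types P : prewalk n.

Let finite_bounded (B : nat) (A : set (prewalk n)) :
  (forall P, A P -> forall i : 'I_n.+1, (height P i <= B)%N) -> finite_set A.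
Proof.
move=> AB.
pose f (p : n.+1.-tuple 'I_B.+1 * n.-tuple step) : prewalk n :=
  ([tuple of [seq val j | j <- p.1]], p.2).
apply: (@sub_finite_set _ _ (f @` setT)); last first.
  exact/finite_image/finite_finset.
move=> [h s] Ahs; exists ([tuple inord (tnth h i) | i < n.+1], s) => //.
rewrite /f /=; congr pair; apply: eq_from_tnth => i.
rewrite !tnth_map tnth_ord_tuple /= inordK //.
by have := AB _ Ahs i; rewrite /height (tnth_nth 0%N) ltnS.
Qed.

Lemma finite_walkM (k : nat) :
  finite_set [set P : prewalk n | walkM P /\ wtM P = k].
Proof.
apply: (@finite_bounded k) => P [_ <-] i.
by rewrite /wtM (bigD1 i) //= leq_addr.
Qed.

Lemma finite_walkO (k : nat) : (0 < n)%N ->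
  finite_set [set P : prewalk n | walkO P /\ wtO P = k].
Proof.
move=> n_gt0; apply: (@finite_bounded k) => P [[_ P0n] <-] i.
have hk (j : 'I_n) : (height P j <= wtO P)%N.
  by rewrite /wtO (bigD1 j) //= leq_addr.
case: (ltnP i n) => [lt_in|le_ni]; first exact: (hk (Ordinal lt_in)).
have -> : (i : nat) = n by apply/eqP; rewrite eqn_leq le_ni andbT -ltnS.
by rewrite -P0n (hk (Ordinal n_gt0)).
Qed.
End Finiteness.

(* Main.v *)
Require Import Defs.
From mathcomp Require Import all_boot all_order all_algebra all_fingroup.
From mathcomp Require Import ring zify finmap.
From mathcomp Require Import boolp classical_sets functions cardinality.

Set Implicit Arguments.
Unset Strict Implicit.
Unset Printing Implicit Defensive.

Import GRing.Theory.

Local Open Scope ring_scope.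

(** The generators of type affine A sit on a cycle of length n, and only
    neighbours on the cycle fail to commute. A word is thus determined up to
    commutations by its subwords on the pairs of letters {i, i + 1}, and it is
    a reduced word of a fully commutative element exactly when all of these
    subwords alternate ([alternating_fc], [fc_alternating]). Let h_i be the
    number of occurrences of i. Alternation makes h_i and h_(i+1) differ by at
    most 1, and if they are equal and positive the subword is known once a
    label tells which letter comes first. So such a word is a closed walk
    satisfying condition (star), of weight its length. The only closed walks
    not obtained are those that would require each letter to precede its
    neighbour all around the cycle: constant positive height and a single
    label ([word_walk_surj]).
    They contribute the two geometric series 2 q^n / (1 - q^n), which is the
    first formula ([affineA_FC_walks], [Ostar_spirals]).

    That alternating words are reduced, with only commutation-equivalent
    reduced expressions, is proved for simply laced Coxeter groups whose
    generators are distinct and satisfy no commutation but the prescribed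
    ones ([fc_word_reduced]). It rests on the exchange property, which follows
      from
    the parity of the number of times a reflection occurs along a word
    ([refl_parity_cls], [exchange]).

    The second formula holds because a closed walk that misses the axis is a
    closed walk lifted by 1, which adds n to the weight ([genfun_free]).

    For the functional equations the walks are counted by their first step,
    and decomposed at their first visit to the axis ([passageP]). Lifting by 1
    is the substitution x -> q x, so this gives
      M = 1 + 2 x M + q x^2 M(q x) M   and
      M* = 1 + x M* + q x^2 M(q x) M*,
    from which the two stated equations follow by elimination. A closed walk
    from height a through the axis is a descent from a, a walk from 0 to 0 and
    an ascent to a; its series is M or M* times a product over the levels
    1, ..., a. The sum of these products over a is 1 + q x^2 (x M)'(q x),
    since both solve B(x) = 1 + q x^2 M(q x)^2 B(q x) ([loop_gf_sum]).
    Uniqueness holds as the equations determine the coefficients one by one. *)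

(** * Power series: coefficients, dilation, derivative, truncation *)

Section Series.
Variable R : comNzRingType.
Implicit Types (f g : fps R) (a : R) (n k : nat).

Lemma fcoefD f g n : coefs (f + g) n = coefs f n + coefs g n. Proof. by []. Qed.
Lemma fcoefB f g n : coefs (f - g) n = coefs f n - coefs g n. Proof. by []. Qed.
Lemma fcoef1 n : coefs (1 : fps R) n = (n == 0%N)%:R. Proof. by []. Qed.
Lemma fcoefM f g n :
  coefs (f * g) n = \sum_(i < n.+1) coefs f i * coefs g (n - i).
Proof. by []. Qed.
Lemma fcoef_sum I (r : seq I) (P : pred I) (F : I -> fps R) n :
  coefs (\sum_(i <- r | P i) F i) n = \sum_(i <- r | P i) coefs (F i) n.
Proof. by elim/big_rec2: _ => //= i x y _ ->. Qed.
Lemma fcoefMn f k n : coefs (f *+ k) n = coefs f n *+ k.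
Proof. by elim: k => // k IH; rewrite !mulrS fcoefD IH. Qed.

Lemma fcoef_bool (b : bool) n :
  coefs (b%:R : fps R) n = (b && (n == 0%N))%:R.
Proof. by case: b. Qed.

Lemma fcoefCM a f n : coefs (fpsC a * f) n = a * coefs f n.
Proof.
by rewrite fcoefM big_ord_recl subn0 big1 ?addr0 // => i _; rewrite mul0r.
Qed.

Lemma fcoefXM0 f : coefs (fpsX * f) 0 = 0.
Proof. by rewrite fcoefM big_ord1 mul0r. Qed.

Lemma fcoefXMS f n : coefs (fpsX * f) n.+1 = coefs f n.
Proof.
rewrite fcoefM 2!big_ord_recl /= mul0r add0r mul1r subSS subn0.
by rewrite big1 ?addr0 // => i _; rewrite mul0r.
Qed.

Lemma fcoefXnM k f n :
  coefs (fpsX ^+ k * f) n = if (n < k)%N then 0 else coefs f (n - k).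
Proof.
elim: k n => [|k IHk] n; first by rewrite mul1r subn0.
by rewrite exprS -mulrA; case: n => [|n];
  rewrite ?fcoefXM0 // fcoefXMS IHk subSS.
Qed.

Lemma fcoefXn k n : coefs (fpsX ^+ k : fps R) n = (n == k)%:R.
Proof.
rewrite -[_ ^+ k]mulr1 fcoefXnM fcoef1 subn_eq0 eqn_leq.
by rewrite andbC; case: ltnP.
Qed.

Lemma fpsCM a b : fpsC (a * b) = fpsC a * fpsC b.
Proof. by apply: fpsP => -[|n]; rewrite fcoefCM //= mulr0. Qed.
Lemma fpsC1 : fpsC 1 = 1 :> fps R.
Proof. by apply: fpsP => -[]. Qed.

Lemma dilateD a f g :
  fps_dilate a (f + g) = fps_dilate a f + fps_dilate a g.
Proof. by apply: fpsP => n /=; rewrite mulrDr. Qed.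
Lemma dilate1 a : fps_dilate a 1 = 1.
Proof. by apply: fpsP => -[|n] /=; rewrite ?mulr0 ?mulr1. Qed.
Lemma dilateM a f g :
  fps_dilate a (f * g) = fps_dilate a f * fps_dilate a g.
Proof.
apply: fpsP => n; rewrite /= mulr_sumr; apply: eq_bigr => i _.
by rewrite -{1}(@subnKC i n) -1?ltnS // exprD mulrACA.
Qed.
Lemma dilateXn a f n : fps_dilate a (f ^+ n) = fps_dilate a f ^+ n.
Proof. by elim: n => [|n IHn]; rewrite ?dilate1 // !exprS dilateM IHn. Qed.
Lemma dilateC a b : fps_dilate a (fpsC b) = fpsC b.
Proof. by apply: fpsP => -[|n] /=; rewrite ?mulr0 ?mul1r. Qed.
Lemma dilateX a : fps_dilate a fpsX = fpsC a * fpsX.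
Proof.
apply: fpsP => n; rewrite fcoefCM /=.
by case: n => [|[|n]]; rewrite /= ?mulr0 // expr1.
Qed.

Lemma fderivD f g : fps_deriv (f + g) = fps_deriv f + fps_deriv g.
Proof. by apply: fpsP => n /=; rewrite mulrnDl. Qed.
Lemma fderiv1 : fps_deriv 1 = 0 :> fps R.
Proof. by apply: fpsP => n /=; rewrite mul0rn. Qed.
Lemma fderivX : fps_deriv fpsX = 1 :> fps R.
Proof. by apply: fpsP => -[|n] /=; rewrite ?mul0rn. Qed.

Lemma fderivM f g :
  fps_deriv (f * g) = fps_deriv f * g + f * fps_deriv g.
Proof.
apply: fpsP => n; rewrite fcoefD !fcoefM /= -sumrMnl.
transitivity (\sum_(i < n.+2) (coefs f i * coefs g (n.+1 - i) *+ i
   + coefs f i * coefs g (n.+1 - i) *+ (n.+1 - i))).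
  apply: eq_bigr => i _; rewrite -mulrnDr subnKC // -ltnS.
  exact: ltn_ord.
rewrite big_split /=; congr (_ + _).
  rewrite big_ord_recl mulr0n add0r; apply: eq_bigr => i _.
  by rewrite lift0 subSS mulrnAl.
rewrite big_ord_recr /= subnn mulr0n addr0; apply: eq_bigr => i _.
by rewrite -subSn ?mulrnAr // -ltnS.
Qed.

Lemma fderiv_dilate a f :
  fps_deriv (fps_dilate a f) = fpsC a * fps_dilate a (fps_deriv f).
Proof. by apply: fpsP => n;
  rewrite fcoefCM /= exprS -mulrA mulrnAr mulrnAr. Qed.

(** Congruence modulo x^k: the equations for M and M* determine each
    coefficient from the earlier ones, because every occurrence of the
    unknown on the right is multiplied by x. *)
Definition eqtrunc k f g := forall j, (j < k)%N -> coefs f j = coefs g j.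

Lemma eqtruncP f g : (forall k, eqtrunc k f g) -> f = g.
Proof. by move=> fg; apply: fpsP => n; apply: (fg n.+1). Qed.
Lemma eqtruncD k f f' g g' :
  eqtrunc k f f' -> eqtrunc k g g' -> eqtrunc k (f + g) (f' + g').
Proof. by move=> ff gg j jk; rewrite !fcoefD ff ?gg. Qed.
Lemma eqtruncM k f f' g g' :
  eqtrunc k f f' -> eqtrunc k g g' -> eqtrunc k (f * g) (f' * g').
Proof.
move=> ff gg j jk; rewrite !fcoefM; apply: eq_bigr => i _.
have ij : (i <= j)%N by rewrite -ltnS.
by rewrite ff ?gg //; apply: leq_ltn_trans jk; rewrite ?leq_subr.
Qed.
Lemma eqtrunc_dilate k a f g :
  eqtrunc k f g -> eqtrunc k (fps_dilate a f) (fps_dilate a g).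
Proof. by move=> fg j jk /=; rewrite fg. Qed.
Lemma eqtruncXM k f g : eqtrunc k f g -> eqtrunc k.+1 (fpsX * f) (fpsX * g).
Proof. by move=> fg [|j] jk; rewrite ?fcoefXM0 ?fcoefXMS ?fg. Qed.

Lemma fps_lregX : GRing.lreg (fpsX : fps R).
Proof.
move=> f g fg; apply: fpsP => n.
have : coefs (fpsX * f) n.+1 = coefs (fpsX * g) n.+1 by rewrite [_ * f]fg.
by rewrite !fcoefXMS.
Qed.

End Series.

(** * Walks counted by their first step *)

Section Transfer.
Variables (R : comNzRingType) (q : R).
Implicit Types (star : bool) (a b n : nat).

(** With star, the labels at height 0 are restricted to L. *)
Definition flat_steps star a : nat := if star && (a == 0%N) then 1 else 2.

(** The walks from height a to height b in n steps, weighted by q to the sum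
    of all heights but the last. *)
Fixpoint walk_sum star n a b : R :=
  if n is n'.+1 then
    q ^+ a * (walk_sum star n' a b *+ flat_steps star a
              + walk_sum star n' a.+1 b
              + (if a is a'.+1 then walk_sum star n' a' b else 0))
  else (a == b)%:R.

(** The same count for walks that reach height 0. From a positive height the
    starting point does not count as a visit, so the first step is free and
    the visit is left to the rest of the walk; from height 0 there is
    nothing left to require. Hence this series does not depend on star until
    the axis is reached. *)
Fixpoint hit_sum star n a b : R :=
  if a is a'.+1 then
    if n is n'.+1 then
      q ^+ a * (hit_sum star n' a b *+ 2 + hit_sum star n' a.+1 b
                + hit_sum star n' a' b)
    else 0
  else walk_sum star n 0 b.

Lemma hit_sum0 star n b : hit_sum star n 0 b = walk_sum star n 0 b.
Proof. by case: n. Qed.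

Lemma walk_sumS star n a b :
  walk_sum star n.+1 a b =
    q ^+ a * (walk_sum star n a b *+ flat_steps star a
              + walk_sum star n a.+1 b
              + (if a is a'.+1 then walk_sum star n a' b else 0)).
Proof. by []. Qed.

(** Matrix powers commute with the matrix: splitting off the last step gives
    the same series as splitting off the first. *)
Lemma walk_sum_last star n a b :
  walk_sum star n.+1 a b =
    q ^+ b * (walk_sum star n a b *+ flat_steps star b)
    + q ^+ b.+1 * walk_sum star n a b.+1
    + (if b is b'.+1 then q ^+ b' * walk_sum star n a b' else 0).
Proof.
elim: n a b => [|n IHn] a b.
  have diag k c d : q ^+ c * ((c == d)%:R *+ k) = q ^+ d * ((c == d)%:R *+ k).
    by case: eqVneq => [->|_] //; rewrite !mul0rn !mulr0.
  have loop : (a == b)%:R *+ flat_steps star a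
            = (a == b)%:R *+ flat_steps star b :> R.
    by case: eqVneq => [->|_]; rewrite ?mul0rn.
  have diag1 := diag 1%N.
  have up : q ^+ a * (a.+1 == b)%:R
          = if b is b'.+1 then q ^+ b' * (a == b')%:R else 0.
    by case: b {loop} => [|b]; rewrite ?mulr0 // eqSS diag1.
  have down : q ^+ a * (if a is a'.+1 then (a' == b)%:R else 0)
          = q ^+ b.+1 * (a == b.+1)%:R.
    by case: a {loop up} => [|a]; rewrite ?mulr0 // eqSS !exprS -!mulrA diag1.
  rewrite [LHS]/= [RHS]/= loop !mulrDr up down -!addrA; congr (_ + _).
    exact: diag.
  exact: addrC.
rewrite [LHS]walk_sumS ![in LHS]IHn.
have -> : (if a is a'.+1 then walk_sum star n.+1 a' b else 0) =
  if a is a'.+1 then q ^+ b * (walk_sum star n a' b *+ flat_steps star b)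
    + q ^+ b.+1 * walk_sum star n a' b.+1
    + (if b is b'.+1 then q ^+ b' * walk_sum star n a' b' else 0) else 0.
  by case: a => // a; rewrite IHn.
have nat_mul c d k : walk_sum star n c d *+ k = walk_sum star n c d * k%:R.
  by rewrite mulr_natr.
rewrite ![in RHS]walk_sumS.
by case: a => [|a]; case: b => [|b]; rewrite ?walk_sumS ?nat_mul; ring.
Qed.

(** Reversing a walk; the powers of q restore the height that the weight
    omits at the other end. *)
Lemma walk_sum_sym star n a b :
  q ^+ b * walk_sum star n a b = q ^+ a * walk_sum star n b a.
Proof.
elim: n a b => [|n IHn] a b.
  by rewrite /= eq_sym; case: eqVneq => [->|_]; rewrite ?mulr0.
have -> : walk_sum star n.+1 b a =
    q ^+ b * (walk_sum star n a b *+ flat_steps star a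
              + walk_sum star n a.+1 b
              + (if a is a'.+1 then walk_sum star n a' b else 0)).
  rewrite walk_sum_last mulrnAr -(IHn a b) -(IHn a.+1 b) -mulrnAr !mulrDr.
  by congr (_ + _); case: a => [|a]; rewrite ?mulr0.
by rewrite walk_sumS mulrCA.
Qed.

Local Notation x := (fpsX : fps R).
Local Notation dil := (fps_dilate q).

Definition walk_gf star a b : fps R := FPS (fun n => walk_sum star n a b).
Definition hit_gf star a b : fps R := FPS (fun n => hit_sum star n a b).
Definition ground_gf star := walk_gf star 0 0.

Lemma walk_gf0 star b :
  walk_gf star 0 b = (b == 0%N)%:R + x *
    (walk_gf star 0 b *+ flat_steps star 0 + walk_gf star 1 b).
Proof.
apply: fpsP => -[|n]; rewrite fcoefD fcoef_bool.
  by rewrite fcoefXM0 addr0 andbT eq_sym.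
by rewrite fcoefXMS fcoefD fcoefMn andbF add0r /= mul1r addr0.
Qed.

Lemma walk_gfS star a b :
  walk_gf star a.+1 b = (b == a.+1)%:R + fpsC (q ^+ a.+1) * (x *
    (walk_gf star a.+1 b *+ 2 + walk_gf star a.+2 b + walk_gf star a b)).
Proof.
apply: fpsP => -[|n]; rewrite fcoefD fcoef_bool fcoefCM.
  by rewrite fcoefXM0 mulr0 addr0 andbT eq_sym.
by rewrite fcoefXMS 2!fcoefD fcoefMn andbF add0r /= /flat_steps andbF.
Qed.

(** The recursion satisfied at positive heights by any series that counts
    walks from height a with a condition that only concerns what happens
    after the axis is reached. *)
Definition passage (Y : nat -> fps R) := forall a,
  Y a.+1 = fpsC (q ^+ a.+1) * (x * (Y a.+1 *+ 2 + Y a.+2 + Y a)).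

(** Every term on the right carries a factor x, so the value at height 0
    determines, one coefficient at a time, the values at all heights. *)
Lemma passage_unique Y Z : passage Y -> passage Z -> Y 0%N = Z 0%N -> Y =1 Z.
Proof.
move=> recY recZ YZ0 a; apply: eqtruncP => k; elim: k a => // k IHk [|a].
  by rewrite YZ0.
rewrite recY recZ; apply: eqtruncM => //; apply: eqtruncXM.
by rewrite !mulr2n; do !apply: eqtruncD; apply: IHk.
Qed.

(** Walks from height a until their first visit to the axis: a walk staying
    above height 0 that ends at height 1, followed by one step down.
    Shifting it down by one turns it into an arbitrary walk from a - 1 to 0,
    whence the dilation by q. *)
Definition descent_gf a : fps R :=
  if a is a'.+1 then fpsC q * x * dil (walk_gf false a' 0) else 1.

Lemma passage_descent : passage descent_gf.
Proof.
case=> [|a].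
  rewrite {1}/descent_gf walk_gf0 eqxx dilateD dilate1 dilateM dilateX.
  rewrite !mulr2n !dilateD expr1 /descent_gf; ring.
rewrite {1}/descent_gf walk_gfS add0r !dilateM dilateC dilateX.
rewrite !mulr2n !dilateD [q ^+ a.+2]exprS fpsCM /descent_gf; ring.
Qed.

(** First passage decomposition: a walk from height a that reaches the axis
    is a first descent followed by a walk from height 0. *)
Lemma passageP Y : passage Y -> forall a, Y a = descent_gf a * Y 0%N.
Proof.
move=> recY; apply: passage_unique => //; last by rewrite mul1r.
by move=> a; rewrite {1}passage_descent; ring.
Qed.

Lemma passage_walk star : passage (fun a => walk_gf star a 0).
Proof. by move=> a; rewrite {1}walk_gfS add0r. Qed.

Lemma passage_hit star b : passage (fun a => hit_gf star a b).
Proof.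
move=> a; apply: fpsP => -[|n]; rewrite fcoefCM ?fcoefXM0 ?mulr0 //.
by rewrite fcoefXMS 2!fcoefD fcoefMn.
Qed.

(** Decomposition by the first step from height 0: flat, or up and then a
    first descent back to 0, followed in both cases by a walk from 0 to 0. *)
Lemma ground_gfE star :
  ground_gf star = 1 + x * (ground_gf star *+ flat_steps star 0)
    + fpsC q * x ^+ 2 * dil (ground_gf false) * ground_gf star.
Proof.
rewrite {1}/ground_gf walk_gf0 eqxx.
rewrite (passageP (@passage_walk star) 1) /= -!/(ground_gf _).
by rewrite mulrDr; ring.
Qed.

Let M := ground_gf false.
Let Ms := ground_gf true.

Lemma ground_gf_false : M = 1 + x * M *+ 2 + fpsC q * x ^+ 2 * dil M * M.
Proof. by rewrite {1}/M ground_gfE -mulrnAr. Qed.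
Lemma ground_gf_true : Ms = 1 + x * Ms + fpsC q * x ^+ 2 * dil M * Ms.
Proof. by rewrite {1}/Ms ground_gfE. Qed.

(** Both series have the same excursions, so 1/M* - 1/M = x: the extra label
    R at height 0. *)
Lemma ground_gf_eq : M = Ms + x * Ms * M.
Proof.
have e1 : M * (1 - x *+ 2 - fpsC q * x ^+ 2 * dil M) = 1.
  by rewrite -[RHS](addrK (x * M *+ 2 + fpsC q * x ^+ 2 * dil M * M)) addrA
    -ground_gf_false; ring.
have e2 : Ms * (1 - x - fpsC q * x ^+ 2 * dil M) = 1.
  by rewrite -[RHS](addrK (x * Ms + fpsC q * x ^+ 2 * dil M * Ms)) addrA
    -ground_gf_true; ring.
have h1 : M = M * Ms * (1 - x - fpsC q * x ^+ 2 * dil M).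
  by rewrite -mulrA e2 mulr1.
have h2 : Ms = M * Ms * (1 - x *+ 2 - fpsC q * x ^+ 2 * dil M).
  by rewrite mulrAC e1 mul1r.
by rewrite [LHS]h1 [X in _ = X + _]h2; ring.
Qed.

(** Elimination of M(q x), by the previous relation with x replaced by q x. *)
Lemma ground_gf_star_eq :
  Ms = 1 + x * Ms + fpsC q * x * (Ms - 1) * dil Ms.
Proof.
have dM : dil M = dil Ms + fpsC q * x * dil Ms * dil M.
  by rewrite -dilateX -!dilateM -dilateD -ground_gf_eq.
have e : Ms - 1 = x * Ms * (1 + fpsC q * x * dil M).
  by rewrite {1}ground_gf_true; ring.
rewrite -[LHS](subrK 1) addrC -addrA; congr (1 + _).
rewrite e -{1}[x * Ms]mulr1.
have -> : fpsC q * x * (x * Ms * (1 + fpsC q * x * dil M)) * dil Ms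
   = fpsC q * x * (x * Ms) * (dil Ms + fpsC q * x * dil Ms * dil M) by ring.
by rewrite -dM; ring.
Qed.

Let E := fps_deriv (x * M).

(** Differentiating x M = x (1 + 2 x M + (x M)(x) (x M)(q x)) gives a linear
    equation for (x M)', whose coefficient is 1/M by the equation of M. *)
Lemma fderiv_ground_gf : E = M ^+ 2 * (1 + fpsC q * x ^+ 2 * dil E).
Proof.
pose N := x * M.
have dN : dil N = fpsC q * x * dil M by rewrite dilateM dilateX.
have MN : M = 1 + N *+ 2 + N * dil N by rewrite dN {1}ground_gf_false /N; ring.
have EE : E = M + x * (E *+ 2 + E * dil N + N * (fpsC q * dil E)).
  have dM : fps_deriv M = E *+ 2 + E * dil N + N * (fpsC q * dil E).
    rewrite {1}MN mulr2n !fderivD fderiv1 fderivM fderiv_dilate -/E.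
    by rewrite mulr2n add0r addrA.
  by rewrite {1}/E fderivM fderivX mul1r dM.
have MM : M * (1 - x *+ 2 - x * dil N) = 1.
  have -> : M * (1 - x *+ 2 - x * dil N) = M - (N *+ 2 + N * dil N).
    by rewrite /N; ring.
  by rewrite {1}MN; ring.
rewrite -[LHS]mulr1 -{1}MM.
have -> : E * (M * (1 - x *+ 2 - x * dil N))
   = M * (E - x * (E *+ 2 + E * dil N)) by ring.
rewrite {1}EE /N; ring.
Qed.

(** The part of a closed walk through the axis from height a that lies
    before its first and after its last visit of height 0; one recursion
    step peels off one level, namely a step down, a step up and the two
    walks at height 1. *)
Fixpoint loop_gf a : fps R :=
  if a is a'.+1 then fpsC q * x ^+ 2 * dil M ^+ 2 * dil (loop_gf a') else 1.

Lemma descent_loop a : descent_gf a ^+ 2 = fpsC (q ^+ a) * loop_gf a.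
Proof.
elim: a => [|a IHa]; first by rewrite fpsC1 mul1r expr1n.
rewrite /= (passageP (@passage_walk false)) -/(ground_gf _) -/M dilateM.
have := congr1 dil IHa; rewrite dilateXn dilateM dilateC => h.
by rewrite [q ^+ a.+1]exprS fpsCM !exprMn h; ring.
Qed.

(** Closed walks from height a through the axis: first descent, walk from 0
    to 0, and the reverse of a descent. The endpoint a is counted once only,
    so q^a has to be cancelled. *)
Lemma hit_diag star a : GRing.lreg q ->
  hit_gf star a a = loop_gf a * ground_gf star.
Proof.
move=> reg_q.
have regC : GRing.lreg (fpsC (q ^+ a)).
  move=> f g /= fg; apply: fpsP => n; apply: (@lregX _ _ a reg_q).
  by rewrite -!fcoefCM fg.
apply: regC.
rewrite /= (passageP (@passage_hit star a)) [RHS]mulrA -descent_loop expr2.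
rewrite mulrCA -[RHS]mulrA; congr (_ * _).
rewrite -(passageP (@passage_walk star)) //; apply: fpsP => n.
by rewrite fcoefCM /= hit_sum0 walk_sum_sym mul1r.
Qed.

(** The series 1 + q x^2 (x M)'(q x) satisfies B(x) = 1 + q x^2 M(q x)^2 B(q
    x), and unfolding this equation produces the terms loop_gf a; the
    remainder after k steps is divisible by x^k. *)
Lemma loop_gf_sum k n : (n < k)%N ->
  coefs (1 + fpsC q * x ^+ 2 * dil E) n = \sum_(a < k) coefs (loop_gf a) n.
Proof.
pose B : fps R := 1 + fpsC q * x ^+ 2 * dil E.
have BE : B = 1 + fpsC q * x ^+ 2 * dil M ^+ 2 * dil B.
  have := congr1 dil fderiv_ground_gf; rewrite dilateM dilateXn -/B => h.
  by rewrite {1}/B h; ring.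
rewrite -fcoef_sum => nk.
suff : eqtrunc k B (\sum_(a < k) loop_gf a) by apply.
elim: k {n nk} => // k IHk.
rewrite big_ord_recl BE; apply: eqtruncD => //.
have -> : \sum_(i < k) loop_gf (lift ord0 i)
   = x * (fpsC q * x * dil M ^+ 2 * dil (\sum_(i < k) loop_gf i)).
  elim: k {IHk} => [|k IHk]; last first.
    by rewrite !big_ord_recr /= dilateD IHk; ring.
  rewrite !big_ord0; apply: fpsP => n.
  have -> : dil (0 : fps R) = 0 by apply: fpsP => j /=; rewrite mulr0.
  by rewrite !mulr0.
have -> : fpsC q * x ^+ 2 * dil M ^+ 2 * dil B
   = x * (fpsC q * x * dil M ^+ 2 * dil B) by ring.
by apply: eqtruncXM; apply: eqtruncM => //; apply: eqtrunc_dilate.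
Qed.

(** Starting heights above n cannot reach the axis and return, so the sum
    over a stops at n. *)
Lemma hit_gf_sum star n : GRing.lreg q ->
  \sum_(a < n.+1) hit_sum star n a a =
    coefs (ground_gf star * (1 + fpsC q * x ^+ 2 * dil E)) n.
Proof.
move=> reg_q; rewrite mulrC fcoefM.
transitivity (\sum_(a < n.+1) coefs (loop_gf a * ground_gf star) n).
  by apply: eq_bigr => a _; rewrite -hit_diag.
rewrite -fcoef_sum -mulr_suml fcoefM; apply: eq_bigr => i _.
by rewrite (loop_gf_sum (ltn_ord i)) fcoef_sum.
Qed.

End Transfer.

(** * Generating functions of sets, and walks as step sequences *)

Section Genfun.
Local Open Scope classical_set_scope.
Local Notation q := (fpsX : fps int).

(** Finiteness is essential: genfun counts an infinite fiber as 0. *)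
Definition finite_fibers (T : choiceType) (A : set T) (wt : T -> nat) :=
  forall k, finite_set [set a | A a /\ wt a = k].

Lemma genfun_sum (I : finType) (T : choiceType) (f : I -> T) (D : pred I)
    (A : set T) (wt : T -> nat) :
  injective f -> (forall t, A t <-> exists2 i, D i & f i = t) ->
  genfun A wt = \sum_(i | D i) q ^+ wt (f i).
Proof.
move=> inj_f defA; apply: fpsP => k; rewrite fcoef_sum /=.
pose D' := [seq i <- enum I | D i && (wt (f i) == k)].
have -> : [set a | A a /\ wt a = k] = [set` [fset f i | i in D']%fset].
  apply/seteqP; split=> t /=.
    case=> /defA[i Di <-] wti; apply/imfsetP; exists i => //=.
    by rewrite mem_filter Di wti eqxx mem_enum.
  case/imfsetP=> i /=; rewrite mem_filter => /andP[/andP[Di /eqP wti] _] ->.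
  by split=> //; apply/defA; exists i.
rewrite set_fsetK card_imfset //= undup_id; last first.
  by rewrite filter_uniq ?enum_uniq.
under [RHS]eq_bigr => i _ do rewrite fcoefXn eq_sym.
rewrite size_filter -sum1_count natr_sum big_mkcond big_enum [RHS]big_mkcond.
by apply: eq_bigr => i _; case: (D i); case: eqP.
Qed.

(** Used with c = 0 to transport the count of group elements to walks, and
    with c = n to lift walks by 1. *)
Lemma genfun_bij (T U : choiceType) (A : set T) (B : set U)
    (wtA : T -> nat) (wtB : U -> nat) (f : T -> U) (c : nat) :
  finite_fibers A wtA ->
  {in A &, injective f} -> (forall u, B u <-> exists2 t, A t & f t = u) ->
  (forall t, A t -> wtB (f t) = (wtA t + c)%N) ->
  genfun B wtB = q ^+ c * genfun A wtA.
Proof.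
move=> finA inj_f defB wt_f; apply: fpsP => k; rewrite fcoefXnM.
case: ltnP => [lt_kc | le_ck].
  rewrite /= (_ : [set a | _] = set0) ?fset_set0 //.
  apply/seteqP; split=> // u /= [/defB[t At <-]].
  by rewrite wt_f // => e; move: lt_kc; rewrite -e ltnNge leq_addl.
rewrite /= (_ : [set a | B a /\ _] = f @` [set a | A a /\ wtA a = (k - c)%N]).
  rewrite fset_set_image; last exact: finA.
  rewrite card_in_imfset //= => x y.
  rewrite !in_fset_set; try exact: finA.
  by rewrite !inE /= => -[Ax _] [Ay _]; apply: inj_f; rewrite inE.
apply/seteqP; split=> u /=.
  case=> /defB[t At <-]; rewrite wt_f // => <-.
  by exists t => //; rewrite addnK.
case=> t [At wtt] <-; split; first by apply/defB; exists t.
by rewrite wt_f // wtt subnK.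
Qed.

Lemma genfunU (T : choiceType) (A B : set T) (wt : T -> nat) :
  finite_fibers A wt -> finite_fibers B wt -> A `&` B = set0 ->
  genfun (A `|` B) wt = genfun A wt + genfun B wt.
Proof.
move=> finA finB disjAB; apply: fpsP => k; rewrite fcoefD /= -natrD.
rewrite (_ : [set a | _] = [set a | A a /\ wt a = k] `|` [set a | B a /\ wt a =
  k]).
  rewrite fset_setU // cardfsU (_ : _ `&` _ = fset0)%fset ?cardfs0 ?subn0 //.
  rewrite -fset_setI // (_ : _ `&` _ = set0) ?fset_set0 //.
  apply/seteqP; split=> // t /= [[At _] [Bt _]].
  by have : (A `&` B) t by []; rewrite disjAB.
by apply/seteqP; split=> t /=; [case=> -[]; tauto | tauto].
Qed.

End Genfun.

Lemma big_step (R : nmodType) (F : step -> R) :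
  \sum_st F st = F Up + F Down + (F FlatL + F FlatR).
Proof.
have bij : bijective step_of_bools.
  by exists bools_of_step => [[[] []]|[]].
rewrite (reindex step_of_bools) /=; last exact: onW_bij.
transitivity (\sum_u \sum_v F (step_of_bools (u, v))).
  by rewrite pair_bigA; apply: eq_bigr => -[].
by rewrite big_bool !big_bool.
Qed.

Lemma big_tuple_cons (R : nmodType) (T : finType) n (F : seq T -> R) :
  \sum_(s : n.+1.-tuple T) F s = \sum_t \sum_(s : n.-tuple T) F (t :: s).
Proof.
rewrite pair_bigA (reindex (fun p :
  T * n.-tuple T => [tuple of p.1 :: p.2])) //=.
exists (fun s => (thead s, [tuple of behead s])) => [[t s] _ | s _] /=.
  by rewrite theadE; congr pair; apply: val_inj.
by apply: val_inj; rewrite /= [in RHS](tuple_eta s).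
Qed.

Section Steps.
Implicit Types (star : bool) (a b : nat) (s : seq step).

Definition next_height a (st : step) : nat :=
  match st with Up => a.+1 | Down => a.-1 | _ => a end.

Definition step_ok star a (st : step) : bool :=
  match st with
  | Down => 0 < a
  | FlatR => ~~ (star && (a == 0%N))
  | _ => true
  end%N.

Fixpoint steps_ok star a s : bool :=
  if s is st :: s' then step_ok star a st && steps_ok star (next_height a st) s'
  else true.

Fixpoint steps_wt a s : nat :=
  if s is st :: s' then (a + steps_wt (next_height a st) s')%N else 0%N.

Fixpoint steps_hit a s : bool :=
  (a == 0%N) ||
  (if s is st :: s' then steps_hit (next_height a st) s' else false).

Lemma steps_okP star a s :
  reflect (forall i, (i < size s)%N ->
             step_ok star (foldl next_height a (take i s)) (nth FlatL s i))
          (steps_ok star a s).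
Proof.
elim: s a => [|st s IHs] a /=; first by constructor.
apply: (iffP andP) => [[st_ok /IHs s_ok] [|i] //= | ok].
  by rewrite ltnS; apply: s_ok.
by split; [apply: (ok 0%N) | apply/IHs => i i_lt; apply: (ok i.+1)].
Qed.

Lemma steps_hitP a s :
  reflect (exists2 i, (i <= size s)%N & foldl next_height a (take i s) = 0%N)
          (steps_hit a s).
Proof.
elim: s a => [|st s IHs] a /=.
  rewrite orbF; apply: (iffP eqP) => [->|[i _]]; first by exists 0%N.
  by case: i.
apply: (iffP orP) => [[/eqP->|/IHs[i i_le hi]]|[[|i] /= i_le hi]].
- by exists 0%N.
- by exists i.+1.
- by left; apply/eqP.
- by right; apply/IHs; exists i.
Qed.

Lemma steps_wtE a s :
  steps_wt a s = \sum_(i < size s) foldl next_height a (take i s).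
Proof.
elim: s a => [|st s IHs] a; first by rewrite big_ord0.
by rewrite big_ord_recl /= IHs.
Qed.

(** A walk is determined by its starting height and its steps; sums over
    walks become sums over tuples of steps. *)
Definition walk_of n a (s : n.-tuple step) : prewalk n :=
  ([tuple of a :: scanl next_height a s], s).

Lemma height_walk_of n a (s : n.-tuple step) i : (i <= n)%N ->
  height (walk_of a s) i = foldl next_height a (take i s).
Proof.
rewrite /height /=; case: i => [|i] i_lt; first by rewrite take0.
by rewrite /= nth_scanl // size_tuple.
Qed.

Lemma walk_of_inj n :
  injective (fun p : nat * n.-tuple step => walk_of p.1 p.2).
Proof.
move=> [a s] [b t] /= e; congr pair; last exact: (congr1 snd e).
exact: (congr1 (fun P => height P 0) e).
Qed.

Lemma wtO_walk_of n a (s : n.-tuple step) : wtO (walk_of a s) = steps_wt a s.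
Proof.
rewrite steps_wtE size_tuple; apply: eq_bigr => i _.
by rewrite height_walk_of // ltnW.
Qed.

Lemma is_stepE st a b : is_step a st b -> b = next_height a st.
Proof. by case: st => /eqP // ->. Qed.

(** Each step forces the next height. *)
Lemma walkE n (P : prewalk n) : is_walk P -> P = walk_of (height P 0) P.2.
Proof.
move=> walkP.
have hP i : (i <= n)%N ->
    height P i = foldl next_height (height P 0) (take i P.2).
  elim: i => [|i IHi] i_le; first by rewrite take0.
  rewrite (take_nth FlatL) ?size_tuple // -cats1 foldl_cat -IHi 1?ltnW //=.
  have := is_stepE (walkP (Ordinal i_le)).
  by rewrite (tnth_nth FlatL).
case: P hP {walkP} => h s hP; congr pair; apply: eq_from_tnth => i.
have i_le : (i <= n)%N by rewrite -ltnS.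
by rewrite !(tnth_nth 0%N) -/(height (h, s) i) hP // -(height_walk_of _ _ i_le).
Qed.

Lemma steps_ok_walk n star a (s : n.-tuple step) :
  steps_ok star a s <->
  is_walk (walk_of a s) /\ (star -> cond_star (walk_of a s)).
Proof.
split=> [/steps_okP ok | [walk cond]].
  split=> [i|st i]; have := ok i; rewrite size_tuple ltn_ord => /(_ isT);
    rewrite -?(height_walk_of _ _ (ltnW (ltn_ord i))) -(tnth_nth FlatL).
    rewrite [height _ i.+1]height_walk_of // (take_nth FlatL) ?size_tuple //.
    rewrite -cats1 foldl_cat -(height_walk_of _ _ (ltnW (ltn_ord i))).
    rewrite -(tnth_nth FlatL) /=.
    by case: (tnth s i) => //=; case: (height _ i).
  by rewrite st => + h0; rewrite h0 => + e; rewrite /= in e; rewrite e.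
apply/steps_okP => i; rewrite size_tuple => i_lt.
have := walk (Ordinal i_lt); have := fun st => cond st (Ordinal i_lt).
rewrite /= -height_walk_of 1?ltnW // (tnth_nth FlatL) /=.
case: (nth _ _ _) => //= [_|condi _]; first by case: (height _ i).
apply/negP => /andP[st /eqP h0].
by apply: (condi st).
Qed.

Variables (R : comNzRingType) (q : R).

Lemma steps_sum_walk star n a b :
  \sum_(s : n.-tuple step | steps_ok star a s && (foldl next_height a s == b))
     q ^+ steps_wt a s = walk_sum q star n a b.
Proof.
elim: n a => [|n IHn] a; rewrite big_mkcond /=.
  rewrite (big_pred1 [tuple]) /=; first by case: eqP.
  by move=> s; apply/esym/eqP; apply: tuple0.
rewrite (big_tuple_cons _ (fun s =>
  if steps_ok star a s && (foldl next_height a s == b)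
   then q ^+ steps_wt a s else 0)) /=.
have sumE st : \sum_(s : n.-tuple step)
    (if step_ok star a st && steps_ok star (next_height a st) s
        && (foldl next_height (next_height a st) s == b)
     then q ^+ (a + steps_wt (next_height a st) s) else 0) =
    if step_ok star a st then q ^+ a * walk_sum q star n (next_height a st) b
      else 0.
  case: step_ok => /=; last by rewrite big1.
  by rewrite -big_mkcond -IHn mulr_sumr /=; apply: eq_bigr => s _;
    rewrite exprD.
under eq_bigr => st _ do rewrite sumE.
rewrite big_step /= /flat_steps.
by case: a {sumE} => [|a]; case: star {IHn} => /=; ring.
Qed.

Lemma steps_sum_hit star n a b :
  \sum_(s : n.-tuple step | [&& steps_ok star a s, foldl next_height a s == b
                              & steps_hit a s])
     q ^+ steps_wt a s = hit_sum q star n a b.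
Proof.
elim: n a => [|n IHn] [|a].
- rewrite hit_sum0 -steps_sum_walk; apply: eq_bigl => s.
  by case: (val s) => *; rewrite /= ?andbT.
- by rewrite big1 // => s; rewrite tuple0 /= andbF.
- rewrite hit_sum0 -steps_sum_walk; apply: eq_bigl => s.
  by case: (val s) => *; rewrite /= ?andbT.
rewrite big_mkcond /= (big_tuple_cons _ (fun s =>
  if [&& steps_ok star a.+1 s,
   foldl next_height a.+1 s == b & steps_hit a.+1 s] then q ^+ steps_wt a.+1 s
     else 0)).
under eq_bigr => st _.
  rewrite (_ : \sum_s _ =
    if step_ok star a.+1 st then q ^+ a.+1 * hit_sum q star n (next_height a.+1
      st) b
    else 0); first over.
  rewrite /=; case: step_ok => /=; last by rewrite big1.
  by rewrite -big_mkcond -IHn mulr_sumr /=; apply: eq_bigr => s _;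
    rewrite exprD.
rewrite big_step /= andbF /=; ring.
Qed.

End Steps.

(** * The series of the walk families *)

Section WalkSeries.
Local Open Scope classical_set_scope.
Local Notation q := (fpsX : fps int).

(** With star = false this is the set of all walks, so that both families
    are treated at once. *)
Definition starred (star : bool) n : set (prewalk n) :=
  [set P | is_walk P /\ (star -> cond_star P)].
Arguments starred : clear implicits.

Lemma starred_walk_of star n P : starred star n P <->
  exists2 p : nat * n.-tuple step, steps_ok star p.1 p.2 & walk_of p.1 p.2 = P.
Proof.
split=> [[walkP condP] | [p /steps_ok_walk ok <-]]; last by [].
exists (height P 0, P.2); last by rewrite -walkE.
by apply/steps_ok_walk; rewrite -walkE.
Qed.

Lemma height_walk_of0 n a (s : n.-tuple step) : height (walk_of a s) 0 = a.
Proof. by []. Qed.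
Lemma height_walk_ofn n a (s : n.-tuple step) :
  height (walk_of a s) n = foldl next_height a s.
Proof. by rewrite height_walk_of // take_oversize ?size_tuple. Qed.

Lemma hits_walk_of n a (s : n.-tuple step) :
  hits_axis (walk_of a s) <-> steps_hit a s.
Proof.
split=> [[i hi] | /steps_hitP[i]].
  apply/steps_hitP; exists i; rewrite ?size_tuple -1?ltnS //.
  by rewrite -height_walk_of // -ltnS.
rewrite size_tuple => i_le hi.
by exists (inord i); rewrite inordK ?ltnS // height_walk_of.
Qed.

Lemma leq_foldl_next_height a (s : seq step) :
  (a <= foldl next_height a s + size s)%N.
Proof.
elim: s a => [|st s IHs] a /=; first by rewrite addn0.
by apply: leq_trans (leq_ltn_trans (IHs (next_height a st)) _); case: st => /=;
  lia.
Qed.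

Lemma ground_genfun star n (A : set (prewalk n)) :
  (forall P, A P <->
     [/\ starred star n P, height P 0 = 0%N & height P n = 0%N]) ->
  genfun A (@wtM n) = walk_sum q star n 0 0.
Proof.
move=> defA; rewrite -steps_sum_walk.
rewrite (@genfun_sum _ _ (@walk_of n 0)
  (fun s => steps_ok star 0 s && (foldl next_height 0%N s == 0%N))).
- apply: eq_bigr => s /andP[_ /eqP end0].
  by rewrite /wtM big_ord_recr /= height_walk_ofn end0 addn0 -wtO_walk_of.
- by move=> s t /(congr1 snd).
move=> P; rewrite defA; split=> [[/starred_walk_of[[a s] /= ok <-]] | [s]].
  rewrite height_walk_of0 height_walk_ofn => a0 end0.
  by exists s; rewrite -a0 ?ok ?end0 ?a0.
case/andP=> ok /eqP end0 <-.
rewrite height_walk_of0 height_walk_ofn; split=> //.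
by apply/starred_walk_of; exists (0%N, s).
Qed.

Lemma loops_genfun star n (A : set (prewalk n)) :
  (forall P, A P <->
     [/\ starred star n P, height P 0 = height P n & hits_axis P]) ->
  genfun A (@wtO n) = \sum_(a < n.+1) hit_sum q star n a a.
Proof.
move=> defA; under eq_bigr => a _ do rewrite -steps_sum_hit.
pose D (a : 'I_n.+1) (s : n.-tuple step) :=
  [&& steps_ok star a s, foldl next_height a s == a & steps_hit a s].
rewrite (pair_big_dep xpredT D (fun a s => q ^+ steps_wt a s)).
rewrite (@genfun_sum _ _ (fun p : 'I_n.+1 * n.-tuple step => walk_of p.1 p.2)
   (fun p => D p.1 p.2)).
- by apply: eq_bigr => p _; rewrite wtO_walk_of.
- by move=> [a s] [b t] /= /(@walk_of_inj _ (_, _) (_, _))[/val_inj -> ->].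
move=> P; rewrite defA; split=> [[/starred_walk_of[[a s] /= ok <-]] | [[a s]]].
  rewrite height_walk_of0 height_walk_ofn => a_end /hits_walk_of hit.
  have a_lt : (a < n.+1)%N.
    have /steps_hitP[i i_le hi] := hit.
    rewrite ltnS; apply: leq_trans (leq_foldl_next_height a (take i s)) _.
    by rewrite hi add0n size_take; case: ifP; move: i_le; rewrite size_tuple;
      lia.
  by exists (Ordinal a_lt, s) => //; rewrite /D /= ok -a_end eqxx hit.
case/and3P=> /= ok /eqP endE hit <-.
rewrite height_walk_of0 height_walk_ofn; split=> //; last exact/hits_walk_of.
by apply/starred_walk_of; exists (val a, s).
Qed.

Lemma M_gfE : M_gf = ground_gf q false.
Proof.
apply: fpsP => n; apply: (@ground_genfun false) => P.
by split=> [[] | [[]]].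
Qed.

Lemma Mstar_gfE : Mstar_gf = ground_gf q true.
Proof.
apply: fpsP => n; apply: (@ground_genfun true) => P.
split=> [[[walkP h0 hn] condP] | [[walkP condP] h0 hn]]; first by [].
by split=> //; apply: condP.
Qed.

Lemma Ocheck_gfE : Ocheck_gf =
  M_gf * (1 + fpsC q * fpsX ^+ 2 * fps_dilate q (fps_deriv (fpsX * M_gf))).
Proof.
apply: fpsP => n; rewrite !M_gfE -(hit_gf_sum _ _ (@fps_lregX int)).
apply: loops_genfun => P.
split=> [[[walkP hn] hit] | [[walkP _] hn hit]]; split=> //.
Qed.

Lemma Ocheckstar_gfE : Ocheckstar_gf =
  Mstar_gf * (1 + fpsC q * fpsX ^+ 2 * fps_dilate q (fps_deriv (fpsX * M_gf))).
Proof.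
apply: fpsP => n; rewrite M_gfE Mstar_gfE -(hit_gf_sum _ _ (@fps_lregX int)).
apply: loops_genfun => P.
split=> [[[[walkP hn] condP] hit] | [[walkP condP] hn hit]]; first by split.
by split=> //; split=> //; apply: condP.
Qed.

Lemma finite_fibersS (T : choiceType) (A B : set T) wt :
  A `<=` B -> finite_fibers B wt -> finite_fibers A wt.
Proof.
by move=> AB finB k; apply: sub_finite_set (finB k) => t /= [/AB].
Qed.

Section Shift.
Variable n : nat.
Hypothesis n_gt0 : (0 < n)%N.

(** Walks that avoid the axis are exactly the walks lifted by one. *)
Definition lift_walk (P : prewalk n) : prewalk n :=
  ([tuple of [seq h.+1 | h <- P.1]], P.2).
Definition lower_walk (P : prewalk n) : prewalk n :=
  ([tuple of [seq h.-1 | h <- P.1]], P.2).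

Lemma height_lift P i : (i <= n)%N -> height (lift_walk P) i = (height P i).+1.
Proof. by move=> i_le; rewrite /height (nth_map 0%N) ?size_tuple. Qed.

Lemma lift_walk_inj : injective lift_walk.
Proof.
move=> [h s] [k t] [/(inj_map succn_inj) hk <-].
by congr pair; apply: val_inj.
Qed.

Lemma lower_walkK P : ~ hits_axis P -> lift_walk (lower_walk P) = P.
Proof.
case: P => h s hit; congr pair; apply: eq_from_tnth => i.
rewrite !tnth_map prednK // lt0n; apply/eqP => h0; apply: hit; exists i.
by rewrite /height -tnth_nth.
Qed.

Lemma lift_walk_is_walk P : is_walk (lift_walk P) <-> is_walk P.
Proof.
have stepE a st b : is_step a.+1 st b.+1 = is_step a st b by case: st.
by split=> walkP i; have := walkP i; rewrite !height_lift ?stepE // ltnW.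
Qed.

Lemma lift_walk_free P : ~ hits_axis (lift_walk P).
Proof. by move=> [i]; rewrite height_lift // -ltnS. Qed.

Lemma wtO_lift P : wtO (lift_walk P) = (wtO P + n)%N.
Proof.
transitivity (\sum_(i < n) (height P i + 1))%N.
  by apply: eq_bigr => i _; rewrite height_lift ?addn1 // ltnW.
by rewrite big_split /= sum1_card card_ord.
Qed.

Definition walkO_free : set (prewalk n) := @walkO n `&` [set P | ~ hits_axis P].

Lemma finite_fibersO : finite_fibers (@walkO n) (@wtO n).
Proof. by move=> k; apply: finite_walkO. Qed.

Lemma walkO_lift P : walkO (lift_walk P) <-> walkO P.
Proof.
rewrite /walkO /= !height_lift // lift_walk_is_walk.
by split=> -[walkP]; [case | move->].
Qed.

(** A lift adds 1 to each of the n heights that are counted. *)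
Lemma genfun_free :
  genfun walkO_free (@wtO n)
  = q ^+ n * genfun (@walkO n) (@wtO n).
Proof.
apply: (@genfun_bij _ _ _ _ _ _ lift_walk) => [|P Q _ _||P _].
- exact: finite_fibersO.
- exact: lift_walk_inj.
- move=> P; split=> [[OP free] | [Q OQ <-]].
    exists (lower_walk P); last exact: lower_walkK.
    by apply/walkO_lift; rewrite lower_walkK.
  by split; [apply/walkO_lift | apply: lift_walk_free].
exact: wtO_lift.
Qed.

Lemma genfunO_split :
  genfun (@walkO n) (@wtO n) = Ocheck_ n + genfun walkO_free (@wtO n).
Proof.
rewrite -genfunU; first (congr genfun; apply/seteqP; split=> P).
- by move=> OP; case: (pselect (hits_axis P)); [left | right].
- by case=> -[].
- by apply: finite_fibersS finite_fibersO => P [].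
- by apply: finite_fibersS finite_fibersO => P [].
by apply/seteqP; split=> // P [[_ hit] [_]].
Qed.

Lemma genfunOstar_split :
  Ostar_ n = Ocheckstar_ n + genfun walkO_free (@wtO n).
Proof.
rewrite -genfunU; first (congr genfun; apply/seteqP; split=> P).
- by move=> OP; case: (pselect (hits_axis P)) => hit; [left | right; case: OP].
- case=> [[] | [OP free]] //; split=> // i h0; case: free.
  by exists (widen_ord (leqnSn n) i).
- by apply: finite_fibersS finite_fibersO => P [[]].
- by apply: finite_fibersS finite_fibersO => P [].
by apply/seteqP; split=> // P [[_ hit] [_]].
Qed.

Lemma unit_1BXn : 1 - q ^+ n \is a GRing.unit.
Proof.
rewrite -[_ \is a _]/(coefs _ 0 \is a GRing.unit) fcoefB fcoefXn.
by rewrite -(prednK n_gt0).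
Qed.

Lemma genfun_geometric A B :
  A = q ^+ n * (B + A) -> A = q ^+ n * B / (1 - q ^+ n).
Proof.
move=> AB; apply: (canRL (mulrK unit_1BXn)).
by rewrite mulrBr mulr1 {1}AB; ring.
Qed.

Lemma Ostar_Ocheck :
  Ostar_ n - (2%:R * q ^+ n) / (1 - q ^+ n)
    = (q ^+ n * (Ocheck_ n - 2%:R)) / (1 - q ^+ n) + Ocheckstar_ n.
Proof.
have := genfun_free; rewrite genfunO_split => /genfun_geometric freeE.
by rewrite genfunOstar_split freeE; ring.
Qed.

(** The closed walks that come from no word: constant positive height and a
    single label. Read on the cycle, such a walk would ask each letter to
    come before its neighbour, all the way around. *)
Definition spiral (l : step) : set (prewalk n) :=
  [set P | exists2 h, (0 < h)%N & P = walk_of h [tuple of nseq n l]].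

Lemma foldl_flat l a k : l = FlatL \/ l = FlatR ->
  foldl next_height a (nseq k l) = a.
Proof. by move=> ll; elim: k => //= k IHk; case: ll IHk => ->. Qed.

Lemma walkO_flat l a : l = FlatL \/ l = FlatR ->
  walkO (walk_of a [tuple of nseq n l]).
Proof.
move=> ll; split; last by rewrite height_walk_ofn foldl_flat.
have /steps_ok_walk[] // : steps_ok false a (nseq n l).
by elim: n => //= k IHk; case: ll IHk => -> /= ->.
Qed.

(** The spirals of height h + 1 are the lifts of the spirals of height h,
    which yields a geometric series of ratio q^n. *)
Lemma genfun_spiral l : l = FlatL \/ l = FlatR ->
  genfun (spiral l) (@wtO n) = q ^+ n / (1 - q ^+ n).
Proof.
move=> ll; pose s := [tuple of nseq n l].
have -> : q ^+ n / (1 - q ^+ n) = q ^+ n * 1 / (1 - q ^+ n) by rewrite mulr1.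
apply: genfun_geometric.
have <- : genfun [set walk_of 0 s] (@wtO n) = 1.
  rewrite (@genfun_sum unit _ (fun=> walk_of 0 s) xpredT) /=; first 1 last.
  - by move=> [] [].
  - by move=> P; split=> [-> | [_ _ ->]]; first by exists tt.
  rewrite big_const card_unit /= addr0 wtO_walk_of steps_wtE big1 // => i _.
  by rewrite take_nseq ?foldl_flat // -[leqRHS](size_tuple s) ltnW.
have finU : finite_fibers [set walk_of h s | h in setT] (@wtO n).
  by apply: finite_fibersS finite_fibersO => _ [h _ <-]; exact: walkO_flat.
rewrite -genfunU; first 1 last.
- by apply: finite_fibersS finU => _ ->; exists 0%N.
- by apply: finite_fibersS finU => _ [h _ ->]; exists h.
- apply/seteqP; split=> // _ [-> [h h_gt0 /(congr1 (fun P => height P 0))]] /=.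
  by move=> /esym h0; move: h_gt0; rewrite (h0 : h = 0%N).
apply: (@genfun_bij _ _ _ _ _ _ lift_walk) => [|P Q _ _||P _].
- by apply: finite_fibersS finU => _ [-> | [h _ ->]]; [exists 0%N | exists h].
- exact: lift_walk_inj.
- have liftE h : lift_walk (walk_of h s) = walk_of h.+1 s.
    rewrite [LHS]walkE ?lift_walk_is_walk; first by [].
    by have [] := walkO_flat h ll.
  move=> P; split=> [[[|h] // _ ->] | [Q Qs <-]].
    by exists (walk_of h s) => //; case: h => [|h]; [left | right; exists h.+1].
  by case: Qs => [-> | [h _ ->]]; rewrite liftE; [exists 1%N | exists h.+1].
exact: wtO_lift.
Qed.

Lemma Ostar_spirals (A : set (prewalk n)) :
  (forall P, A P <->
     [/\ @walkOstar n P, ~ spiral FlatL P & ~ spiral FlatR P]) ->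
  genfun A (@wtO n) = Ostar_ n - (2%:R * q ^+ n) / (1 - q ^+ n).
Proof.
move=> defA.
have OD l : l = FlatL \/ l = FlatR -> spiral l `<=` @walkOstar n.
  move=> ll _ [h h_gt0 ->]; split; first exact: walkO_flat.
  move=> i; have i_le : (i <= n)%N by apply/ltnW/ltn_ord.
  by rewrite height_walk_of // take_nseq // foldl_flat // => h0;
    rewrite h0 in h_gt0.
have finS : finite_fibers (@walkOstar n) (@wtO n).
  by apply: finite_fibersS finite_fibersO => P [].
have [LL RR] : (FlatL = FlatL \/ FlatL = FlatR)
    /\ (FlatR = FlatL \/ FlatR = FlatR).
  by split; [left | right].
have disj : spiral FlatL `&` spiral FlatR = set0.
  apply/seteqP; split=> // P [[h _ ->] [k _ /(congr1 snd) /=]].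
  move=> /(congr1 (fun s : n.-tuple step => val s)) /=.
  by case: n n_gt0.
have finLR : finite_fibers (spiral FlatL `|` spiral FlatR) (@wtO n).
  by apply: finite_fibersS finS => P [/(OD _ LL) | /(OD _ RR)].
have finA : finite_fibers A (@wtO n).
  by apply: finite_fibersS finS => P /defA[].
rewrite /Ostar_ (_ : @walkOstar n = A `|` (spiral FlatL `|` spiral FlatR)).
  rewrite genfunU // ?genfunU //.
  - by rewrite !genfun_spiral //; ring.
  - by apply: finite_fibersS finS; apply: OD.
  - by apply: finite_fibersS finS; apply: OD.
  by apply/seteqP; split=> // P [/defA[_ nL nR] [/nL | /nR]].
apply/seteqP; split=> P; last first.
  by case=> [/defA[] | [/(OD _ LL) | /(OD _ RR)]].
move=> OP; case: (pselect (spiral FlatL P)) => [|nL]; first by right; left.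
case: (pselect (spiral FlatR P)) => [|nR]; first by right; right.
by left; apply/defA.
Qed.

End Shift.

Lemma Mstar_unique (F G : fps (fps int)) :
  F = 1 + fpsX * F + fpsC q * fpsX * (F - 1) * fps_dilate q F ->
  G = 1 + fpsX * G + fpsC q * fpsX * (G - 1) * fps_dilate q G -> F = G.
Proof.
move=> eqF eqG; apply: eqtruncP; elim=> // k IHk; rewrite eqF eqG.
have out H : fpsC q * fpsX * (H - 1) * fps_dilate q H
    = fpsX * (fpsC q * (H - 1) * fps_dilate q H) by ring.
rewrite !out.
apply: eqtruncD; first by apply: eqtruncD => //; apply: eqtruncXM.
apply: eqtruncXM; do 2?apply: eqtruncM => //; last exact: eqtrunc_dilate.
exact: eqtruncD.
Qed.

Lemma M_unique (F G H : fps (fps int)) :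
  G = F + fpsX * F * G -> H = F + fpsX * F * H -> G = H.
Proof.
move=> eqG eqH; apply: eqtruncP; elim=> // k IHk; rewrite eqG eqH.
rewrite -!mulrA.
by apply: eqtruncD => //; apply: eqtruncXM; apply: eqtruncM.
Qed.

End WalkSeries.

(** * Coxeter groups: exchange, and fully commutative words *)

Section Reflections.
Local Open Scope group_scope.
Variables (S : finType) (m : coxeter_matrix S).
Implicit Types (s t b c : S) (u v w x y : seq S).
Notation W := (coxeter_group m).
Notation gen := (cox_gen m).
Notation cls := (cox_class m).

Lemma cls_cat u v : cls (u ++ v) = cls u * cls v.
Proof. exact: cox_class_cat. Qed.
Lemma cls_nil : cls [::] = 1. Proof. by []. Qed.
Lemma cls_cons s w : cls (s :: w) = gen s * cls w.
Proof. by rewrite -cls_cat. Qed.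
Lemma cls_seq1 s : cls [:: s] = gen s. Proof. by []. Qed.

Lemma gen_gen s : gen s * gen s = 1.
Proof.
rewrite -!cls_seq1 -cls_cat; apply/cox_classP.
have mss : m s s = 1%N by apply/eqP; rewrite cox_m_diag.
by have := CoxRel m [::] [::] s s; rewrite mss.
Qed.

Lemma gen_genK s : involutive (fun g : W => gen s * g).
Proof. by move=> g; rewrite mulgA gen_gen mul1g. Qed.

Lemma genV s : (gen s)^-1 = gen s.
Proof. by rewrite -[LHS]mulg1 -(gen_gen s) mulKg. Qed.

(** The reflections attached to a word s_1 ... s_k, that is s_1 ... s_(i-1)
    s_i s_(i-1) ... s_1. *)
Fixpoint refls w : seq W :=
  if w is s :: w' then gen s :: [seq gen s * r * gen s | r <- refls w'] else
    [::].

Lemma size_refls w : size (refls w) = size w.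
Proof. by elim: w => //= s w IHw; rewrite size_map IHw. Qed.

Lemma conj_gen_inj s : injective (fun r : W => gen s * r * gen s).
Proof. by move=> r r' /mulIg /mulgI. Qed.

Lemma refls_cat u v :
  refls (u ++ v) = refls u ++ [seq cls u * r * (cls u)^-1 | r <- refls v].
Proof.
elim: u => [|s u IHu] /=.
  by rewrite -[LHS]map_id; apply: eq_map => r;
    rewrite cls_nil mul1g invg1 mulg1.
rewrite IHu map_cat -map_comp; congr (_ :: (_ ++ _)); apply: eq_map => r /=.
by rewrite cls_cons invgM genV !mulgA.
Qed.

(** In the dihedral word (s t)^k, with p = s t, the reflection of index i is
    p^i s, since s p = p^-1 s. *)
Lemma refls_alternating s t k :
  refls (flatten (nseq k [:: s; t])) =
    [seq (gen s * gen t) ^+ i * gen s | i <- iota 0 (k + k)%N].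
Proof.
elim: k => // k IHk; rewrite -[nseq k.+1 _]/([:: s; t] :: nseq k _) /= IHk.
rewrite addnS /= expg0 mul1g expg1; congr [:: _, _ & _].
rewrite -!map_comp (iotaDl 2 0) -map_comp; apply: eq_map => i /=.
by rewrite add2n expgS expgSr !mulgA.
Qed.

Definition refl_parity w (r : W) : bool := odd (count_mem r (refls w)).

Lemma refl_parity_cat u v r :
  refl_parity (u ++ v) r =
    refl_parity u r (+) refl_parity v ((cls u)^-1 * r * cls u).
Proof.
rewrite /refl_parity refls_cat count_cat oddD count_map; congr (_ (+) odd _).
apply: eq_count => r' /=; apply/eqP/eqP => [<-|->].
  by rewrite !mulgA mulVg mul1g mulgVK.
by rewrite !mulgA mulgV mul1g mulgK.
Qed.

Lemma cls_relator s t : cls (flatten (nseq (m s t) [:: s; t])) = 1.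
Proof.
by rewrite -cls_nil; apply/cox_classP; have := CoxRel m [::] [::] s t;
  rewrite !cats0.
Qed.

Lemma cls_alternating s t k :
  cls (flatten (nseq k [:: s; t])) = (gen s * gen t) ^+ k.
Proof.
elim: k => // k IHk; rewrite -[nseq k.+1 _]/([:: s; t] :: nseq k _) /=.
by rewrite !cls_cons IHk expgS mulgA.
Qed.

(** Since p^m = 1, the list of 2 m reflections of the relator consists of
    two equal halves. *)
Lemma refl_parity_relator s t r :
  refl_parity (flatten (nseq (m s t) [:: s; t])) r = false.
Proof.
have pm : (gen s * gen t) ^+ m s t = 1 by rewrite -cls_alternating cls_relator.
rewrite /refl_parity refls_alternating iotaD add0n map_cat count_cat.
have -> : iota (m s t) (m s t) = map (addn (m s t)) (iota 0 (m s t)).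
  by rewrite -iotaDl addn0.
rewrite -map_comp.
rewrite [X in (_ + count _ X)%N](_ : _ =
   [seq (gen s * gen t) ^+ i * gen s | i <- iota 0 (m s t)]) ?addnn ?odd_double
     //.
by apply: eq_map => i /=; rewrite expgnDr pm mul1g.
Qed.

(** Inserting a relator adds every reflection an even number of times and
    does not move the others, so the parity of the multiplicity of a
    reflection depends on the group element only. *)
Lemma refl_parity_cls u v : cls u = cls v -> refl_parity u =1 refl_parity v.
Proof.
move/cox_classP; elim=> {u v} // [u v _ IH r|u v w _ IH1 _ IH2 r|u v s t r].
- by rewrite IH.
- by rewrite IH1.
rewrite !refl_parity_cat refl_parity_relator cls_relator addFb.
by rewrite invg1 mul1g mulg1.
Qed.

Lemma mem_refls w r : r \in refls w ->
  exists x c y, w = x ++ c :: y /\ r * cls x = cls x * gen c.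
Proof.
elim: w r => //= s w IHw r; rewrite inE => /orP[/eqP-> | /mapP[r' rw ->]].
  by exists [::], s, w; rewrite cls_nil mul1g mulg1.
have [x [c [y [-> rx]]]] := IHw _ rw; exists (s :: x), c, y; split=> //.
by rewrite cls_cons -!mulgA gen_genK rx !mulgA.
Qed.

Lemma gen_mem_refls s w : (gen s \in [seq gen s * r * gen s | r <- refls w])
  = (gen s \in refls w).
Proof.
by rewrite -[RHS](mem_map (@conj_gen_inj s)) gen_gen mul1g.
Qed.

(** Deletion: two equal reflections allow the corresponding two letters to
    be removed. *)
Lemma refls_dup_shorten w : ~~ uniq (refls w) ->
  exists2 v, cls v = cls w & (size v < size w)%N.
Proof.
elim: w => //= s w IHw; rewrite negb_and negbK gen_mem_refls => /orP[|].
  case/mem_refls=> x [c [y [-> sx]]]; exists (x ++ y).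
    by rewrite cls_cons !cls_cat cls_cons mulgA sx -mulgA gen_genK.
  by rewrite !size_cat /=; lia.
rewrite map_inj_uniq; last exact: conj_gen_inj.
by case/IHw=> v vw v_lt; exists (s :: v); rewrite ?cls_cons ?vw.
Qed.

(** A reflection that occurs once occurs an odd number of times, hence at
    least once, for every other word of the same element. So the words
    without repeated reflection are the reduced ones. *)
Lemma refls_uniq_min w v : uniq (refls w) -> cls v = cls w ->
  (size w <= size v)%N.
Proof.
move=> uniq_w vw; rewrite -(size_refls w) -(size_refls v).
apply: uniq_leq_size => // r rw; have := refl_parity_cls vw r.
rewrite /refl_parity (count_uniq_mem _ uniq_w) rw => odd_r.
by rewrite -has_pred1 has_count; case: count odd_r.
Qed.

(** The repetition can only involve the new letter b, as u itself has none. *)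
Lemma exchange b u : uniq (refls u) -> ~~ uniq (refls (b :: u)) ->
  exists x c y, u = x ++ c :: y /\ cls (b :: x) = cls (x ++ [:: c]).
Proof.
move=> uniq_u; rewrite /= map_inj_uniq; last exact: conj_gen_inj.
rewrite uniq_u andbT negbK gen_mem_refls => /mem_refls[x [c [y [-> bx]]]].
by exists x, c, y; split=> //; rewrite cls_cons cls_cat.
Qed.

Local Notation comm := (commutation_eq m).

Lemma comm_refl w : comm w w. Proof. exact: CommRefl. Qed.

Lemma comm_trans v u w : comm u v -> comm v w -> comm u w.
Proof.
elim=> {u v} // u v s t w' mst _ IH w'w; apply: CommStep mst _; exact: IH.
Qed.

Lemma comm_swap x y s t : m s t = 2%N ->
  comm (x ++ [:: s; t] ++ y) (x ++ [:: t; s] ++ y).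
Proof. by move=> mst; apply: CommStep mst _; exact: CommRefl. Qed.

Lemma comm_sym u v : comm u v -> comm v u.
Proof.
elim=> {u v} [u|u v s t w mst _ IH]; first exact: CommRefl.
by apply: comm_trans IH _; apply: comm_swap; rewrite cox_m_sym.
Qed.

Lemma comm_cat x y u v : comm u v -> comm (x ++ u ++ y) (x ++ v ++ y).
Proof.
elim=> {u v} [u|u v s t w mst _ IH]; first exact: CommRefl.
rewrite -!catA in IH *; rewrite catA; apply: CommStep mst _.
by rewrite -catA.
Qed.

Lemma comm_cons s u v : comm u v -> comm (s :: u) (s :: v).
Proof. by move=> uv; have := comm_cat [:: s] [::] uv; rewrite !cats0. Qed.

Lemma comm_past s y : (forall t, t \in y -> m s t = 2%N) ->
  comm (s :: y) (y ++ [:: s]).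
Proof.
elim: y => [|t y IHy] sy; first exact: comm_refl.
apply: (@comm_trans (t :: s :: y)).
  by apply: (@comm_swap [::] y); rewrite sy ?mem_head.
by apply: comm_cons; apply: IHy => r ry; rewrite sy // inE ry orbT.
Qed.

Lemma comm_perm u v : comm u v -> perm_eq u v.
Proof.
elim=> {u v} // u v s t w mst _; apply: perm_trans.
by rewrite perm_cat2l perm_cat2r (perm_catC [:: s] [:: t]).
Qed.

Lemma gen_comm s t : m s t = 2%N -> gen s * gen t = gen t * gen s.
Proof.
move=> mst; have := cls_relator s t; rewrite mst cls_alternating expg2.
by move=> /(canRL (mulKg _)); rewrite mulg1 invgM !genV.
Qed.

Lemma comm_cls u v : comm u v -> cls u = cls v.
Proof.
elim=> {u v} // u v s t w mst _ <-; rewrite !cls_cat; congr (_ * (_ * _)).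
by rewrite !cls_cons cls_nil !mulg1 gen_comm.
Qed.

(** By (s t)^3 = 1 the two sides have product 1, and each is an involution. *)
Lemma gen_braid s t : m s t = 3%N ->
  gen s * gen t * gen s = gen t * gen s * gen t.
Proof.
move=> mst; have p3 := cls_relator s t;
  rewrite mst cls_alternating expgS expg2 in p3.
have /(canRL (mulgK _)) : gen s * gen t * gen s * (gen t * gen s * gen t) = 1.
  by rewrite -p3 !mulgA.
by rewrite mul1g !invgM !genV !mulgA.
Qed.

(** Words all of whose commutation rearrangements avoid squares and braids
    of length 3. This local condition characterizes the reduced words of
    fully commutative elements, by [fully_commutative_fc_word] and
    [fc_word_reduced]. *)
Definition fc_word w := forall v, comm w v ->
  (forall x s y, v <> x ++ [:: s; s] ++ y) /\
  (forall x s t y, m s t = 3%N -> v <> x ++ [:: s; t; s] ++ y).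

Lemma fc_word_comm u v : comm u v -> fc_word u -> fc_word v.
Proof. by move=> uv fcu w vw; apply: fcu; exact: comm_trans vw. Qed.

Lemma fc_word_factor x w y : fc_word (x ++ w ++ y) -> fc_word w.
Proof.
move=> fc v wv; have [nil2 braid] := fc _ (comm_cat x y wv).
split=> [x' s y' e | x' s t y' mst e]; [apply: (nil2 (x ++ x') s (y' ++ y)) |
  apply: (braid (x ++ x') s t (y' ++ y) mst)]; by rewrite e -!catA.
Qed.

Lemma fc_word_catl x y : fc_word (x ++ y) -> fc_word x.
Proof. exact: (@fc_word_factor [::]). Qed.
Lemma fc_word_catr x y : fc_word (x ++ y) -> fc_word y.
Proof. by move=> fc; apply: (@fc_word_factor x _ [::]); rewrite cats0. Qed.

Hypothesis simply_laced : forall s t, m s t = 1%N \/ m s t = 2%N \/ m s t = 3%N.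
Hypothesis gen_inj : injective gen.
Hypothesis gen_noncomm : forall s t,
  m s t = 3%N -> gen s * gen t <> gen t * gen s.

Let IH_for w := uniq (refls w) /\
  forall v, cls v = cls w -> (size v <= size w)%N -> comm w v.

(** If b u were not reduced, exchange would give b x = x c for a prefix x c
    of u. By induction these words agree up to commutations, so b u can be
    rearranged to start with b b. *)
Lemma fc_word_uniq w :
  (forall v, (size v < size w)%N -> fc_word v -> IH_for v) ->
  fc_word w -> uniq (refls w).
Proof.
case: w => // b u IH fc; have fcu : fc_word u := @fc_word_catr [:: b] u fc.
have [uniq_u _] := IH u (ltnSn _) fcu.
apply/negPn/negP => /(exchange uniq_u)[x [c [y [uE bx]]]].
have fcxc : fc_word (x ++ [:: c]).
  by apply: (@fc_word_catl _ y); rewrite -catA -uE.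
have [|_ xcE] := IH (x ++ [:: c]) _ fcxc.
  by rewrite uE /= !size_cat /=; lia.
have xc_bx : comm (x ++ [:: c]) (b :: x).
  by apply: xcE; rewrite // size_cat /= addn1.
have w_bb : comm (b :: u) ([:: b; b] ++ x ++ y).
  by rewrite uE; have := comm_cat [:: b] y xc_bx; rewrite -!catA.
by have [/(_ [::] b (x ++ y))] := fc _ w_bb.
Qed.

(** A left descent t of the element of b u can be brought to the front by
    commutations. By exchange, t y = y a for a prefix y a of b u; unless
    this prefix is the whole word, induction applies. Otherwise the word is
    b x a, where b x a = t b x. If t and b commute, cancelling b leaves a
    shorter instance. If they do not, a second exchange, of b against the
    reduced word t b x, writes the element as b t b x2 y1; cancelling b and
    applying induction, the word can be rearranged to start with the braid b
    t b, which is excluded. *)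
Lemma fc_word_left_descent b u t : fc_word (b :: u) ->
  (forall v, (size v <= size u)%N -> fc_word v -> IH_for v) ->
  uniq (refls (b :: u)) -> t != b -> ~~ uniq (refls (t :: b :: u)) ->
  exists2 x, comm (b :: u) (t :: x) & size x = size u.
Proof.
move=> fc IH uniq_w neq_tb /(exchange uniq_w)[x [a [y [wE tx]]]].
suff xa_tx : comm (x ++ [:: a]) (t :: x).
  exists (x ++ y).
    by rewrite wE; have := comm_cat [::] y xa_tx; rewrite -!catA.
  by have := congr1 size wE; rewrite !size_cat /=; lia.
have fc_xa : fc_word (x ++ [:: a]).
  by apply: (@fc_word_catl _ y); rewrite -catA -wE.
have [y0 | y_gt0] := posnP (size y); last first.
  have [|_ xaE] := IH (x ++ [:: a]) _ fc_xa.
    by have := congr1 size wE; rewrite !size_cat /=; lia.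
  by apply: xaE; rewrite // size_cat /= addn1.
move/size0nil: y0 wE => -> wE {y}.
case: x wE tx fc_xa => [|b' x] /= wE tx fc_xa.
  by move: tx; rewrite !cls_seq1 => /gen_inj ->; exact: comm_refl.
case: wE => [<- uE] in tx fc_xa *; rewrite {b'}.
have xa_le : (size (x ++ [:: a]) <= size u)%N by rewrite uE.
have fc_x_a : fc_word (x ++ [:: a]) by exact: (@fc_word_catr [:: b]).
have [_ xaE] := IH _ xa_le fc_x_a.
have xa_btbx : cls (x ++ [:: a]) = gen b * gen t * gen b * cls x.
  apply: (@mulgI _ (gen b)); rewrite -cls_cons -tx !cls_cons !mulgA.
  by rewrite gen_gen mul1g.
have [mtb|[mtb|mtb]] := simply_laced t b.
- by case/eqP: neq_tb; apply/eqP; rewrite -(cox_m_diag m) mtb.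
- have : comm (x ++ [:: a]) (t :: x).
    apply: xaE; last by rewrite size_cat /= addn1.
    by rewrite xa_btbx -(mulgA (gen b)) gen_comm // mulgA gen_gen mul1g
      cls_cons.
  move=> /(comm_cons b) /comm_trans; apply.
  by apply: (@comm_swap [::]); rewrite cox_m_sym.
pose z := t :: b :: x.
have z_w : cls z = cls (b :: u) by rewrite uE -tx.
have sz_u : size u = (size x).+1 by rewrite uE size_cat /= addn1.
have uniq_z : uniq (refls z).
  apply/negPn/negP => /refls_dup_shorten[v];
    rewrite z_w => /(refls_uniq_min uniq_w).
  by rewrite /= sz_u; lia.
have dup_bz : ~~ uniq (refls (b :: z)).
  apply/negP => /(@refls_uniq_min _ u).
  rewrite cls_cons z_w cls_cons gen_genK /= sz_u => /(_ erefl); lia.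
have [x1 [c [y1 [zE bx1]]]] := exchange uniq_z dup_bz.
case: x1 zE bx1 => [|t' [|b' x2]] /=.
- case=> <- _; rewrite !cls_seq1 => /gen_inj e.
  by rewrite e eqxx in neq_tb.
- case=> <- <- _; rewrite !cls_cons cls_nil !mulg1 => /esym.
  by move/gen_noncomm: mtb.
case=> <- <- xE bx2.
have : comm (x ++ [:: a]) (t :: b :: x2 ++ y1).
  apply: xaE; last by rewrite xE !size_cat /= !size_cat /=; lia.
  rewrite xa_btbx xE; have := bx2;
    rewrite !cls_cons !cls_cat !cls_cons cls_nil mulg1.
  move=> e.
  rewrite (_ : gen b * gen t * gen b * (cls x2 * (gen c * cls y1)) =
    gen b * (gen t * (gen b * (cls x2 * gen c)) * cls y1));
      last by rewrite !mulgA.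
  by rewrite -e -!mulgA gen_genK.
move=> /(comm_cons b); rewrite -uE => w_btb.
have [_ /(_ [::] b t (x2 ++ y1))] := fc _ w_btb.
by rewrite cox_m_sym => /(_ mtb).
Qed.

(** Induction on the length, moving the first letter of the other expression
    to the front and cancelling it. This replaces an appeal to Matsumoto's
    theorem. *)
Lemma fc_word_reduced w : fc_word w -> uniq (refls w) /\
  forall v, cls v = cls w -> (size v <= size w)%N -> comm w v.
Proof.
move: {2}(size w) (leqnn (size w)) => n; elim: n w => [|n IHn] w.
  case: w => // _ _; split=> // v _; rewrite leqn0 => /nilP ->;
    exact: comm_refl.
case: w => [|b u] w_le fc; first exact: IHn.
have IH v : (size v <= size u)%N -> fc_word v -> IH_for v.
  by move=> v_le; apply: IHn; apply: leq_trans v_le _.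
have uniq_w : uniq (refls (b :: u)).
  by apply: fc_word_uniq fc => v v_lt; apply: IH.
split=> // -[|t v] vw v_le; first by have := refls_uniq_min uniq_w vw.
have [x w_tx sz_x] : exists2 x, comm (b :: u) (t :: x) & size x = size u.
  have [->|neq_tb] := eqVneq t b; first by exists u; [exact: comm_refl |].
  apply: fc_word_left_descent => //; apply/negP => /(@refls_uniq_min _ v).
  by rewrite [cls (t :: _)]cls_cons -vw cls_cons gen_genK => /(_ erefl);
    move: v_le => /=; lia.
apply: (comm_trans w_tx); apply: comm_cons.
have fcx : fc_word x by apply: (@fc_word_catr [:: t]);
  apply: fc_word_comm w_tx fc.
have [|_] := IH x _ fcx; first by rewrite sz_x.
apply; last by rewrite sz_x.
apply: (@mulgI _ (gen t)); rewrite -!cls_cons vw; exact: comm_cls w_tx.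
Qed.

Lemma cox_length_min w : (cox_length (cls w) <= size w)%N.
Proof.
rewrite /cox_length; case: ex_minnP => l _; apply.
by apply/asboolP; exists w; rewrite // /expression prod_cox_gen.
Qed.

Lemma reduced_expressionP w : reduced_expression w (cls w) <-> uniq (refls w).
Proof.
split=> [[_ w_min] | uniq_w].
  apply/negPn/negP => /refls_dup_shorten[v vw].
  by rewrite w_min -vw ltnNge cox_length_min.
split; first by rewrite /expression prod_cox_gen.
apply/eqP; rewrite eqn_leq cox_length_min andbT /cox_length.
case: ex_minnP => l /asboolP[v]; rewrite /expression prod_cox_gen => vw <- _.
exact: refls_uniq_min vw.
Qed.

Lemma reduced_expression_cls w g : reduced_expression w g -> cls w = g.
Proof. by case; rewrite /expression prod_cox_gen. Qed.

Lemma reduced_expression_exists (g : W) : exists w, reduced_expression w g.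
Proof.
have := erefl (cox_length g); rewrite {1}/cox_length.
case: ex_minnP => l /asboolP[w wg <-] _ sz_w.
by exists w.
Qed.

Lemma fc_word_fully_commutative w : fc_word w ->
  reduced_expression w (cls w) /\ @fully_commutative _ m (cls w).
Proof.
move=> /fc_word_reduced[uniq_w commE].
have w_red : reduced_expression w (cls w) by apply/reduced_expressionP.
have red_comm v : reduced_expression v (cls w) -> comm w v.
  move=> v_red; apply: commE; first exact: reduced_expression_cls.
  by case: v_red w_red => _ -> [_ ->].
split=> // u v /red_comm wu /red_comm wv.
exact: comm_trans (comm_sym wu) wv.
Qed.

(** A square contradicts reducedness. A braid s t s can be replaced by t s t
    in another reduced expression, which has one s less and so is not
    reached by commutations. *)
Lemma fully_commutative_fc_word w g :
  reduced_expression w g -> @fully_commutative _ m g -> fc_word w.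
Proof.
move=> w_red fc v wv.
have sz_v : size v = cox_length g.
  by rewrite -(perm_size (comm_perm wv)); case: w_red.
have v_cls : cls v = g by rewrite -(comm_cls wv); apply: reduced_expression_cls.
split=> [x s y e | x s t y mst e].
  have := cox_length_min (x ++ y).
  have -> : cls (x ++ y) = g.
    by rewrite -v_cls e !cls_cat !cls_cons cls_nil mulg1 gen_gen mul1g.
  by rewrite -sz_v e !size_cat /=; lia.
have v'_red : reduced_expression (x ++ [:: t; s; t] ++ y) g.
  split; last by rewrite -sz_v e !size_cat.
  rewrite /expression prod_cox_gen -v_cls e !cls_cat !cls_cons cls_nil !mulg1.
  by rewrite !mulgA -!(mulgA (cls x)) -gen_braid.
have v_red : reduced_expression v g.
  by split; rewrite // /expression prod_cox_gen.
have /seq.permP/(_ (pred1 s)) := comm_perm (fc _ _ v_red v'_red).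
have neq_st : (t == s) = false.
  by apply/negP => /eqP ts; have := cox_m_diag m s t; rewrite mst ts eqxx.
by rewrite e !count_cat /= eqxx neq_st; lia.
Qed.

End Reflections.

(** * Affine type A: fully commutative means alternating *)

Lemma split_first (T : eqType) (s : T) (w : seq T) :
  s \in w -> exists x y, w = x ++ s :: y /\ s \notin x.
Proof.
move=> sw; exists (take (index s w) w), (drop (index s w).+1 w).
split; last by rewrite in_take_leq ?ltnn // index_size.
have := @drop_nth _ s (index s w) w; rewrite index_mem nth_index // => <- //.
by rewrite cat_take_drop.
Qed.

Section AffineA.
Variable n : nat.
Notation m := (affineA n).
Implicit Types (i j s t : 'I_n) (u v w x y : seq 'I_n).

Lemma val_ordS i : ordS i = (if (i.+1 < n)%N then i.+1 else 0%N) :> nat.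
Proof.
rewrite /=; case: ltnP => [i_lt | i_ge]; first by rewrite modn_small.
by rewrite (_ : i.+1 = n) ?modnn //; have := ltn_ord i; lia.
Qed.

Hypothesis n_ge3 : (3 <= n)%N.

Lemma ordS_neq i : (ordS i == i) = false.
Proof.
by apply/negP => /eqP/(congr1 (@nat_of_ord n)); rewrite val_ordS;
  case: ltnP => /=; lia.
Qed.

Lemma ordSS_neq i : (ordS (ordS i) == i) = false.
Proof.
apply/negP => /eqP/(congr1 (@nat_of_ord n)); rewrite !val_ordS.
move: (ltn_ord i) n_ge3; case: (ltnP i.+1 n) => h1;
  first case: (ltnP i.+2 n) => h2; case: (ltnP 1 n) => h3; lia.
Qed.

Lemma affineA_mE s t : m s t =
  if s == t then 1%N else if (t == ordS s) || (s == ordS t) then 3%N else 2%N.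
Proof. by []. Qed.

Lemma affineA_simply_laced s t : m s t = 1%N \/ m s t = 2%N \/ m s t = 3%N.
Proof. by rewrite affineA_mE; do 2?case: ifP; auto. Qed.

Lemma affineA_m3 s t : m s t = 3%N -> t = ordS s \/ s = ordS t.
Proof.
by rewrite affineA_mE; case: ifP => // _; case: ifP => // /orP[] /eqP; auto.
Qed.

Section CyclicTranspositions.
Local Open Scope group_scope.

Let transp i : 'S_n := tperm i (ordS i).

Let transp2 i : transp i * transp i = 1. Proof. exact: tperm2. Qed.

(** Both sides are the transposition of i and i + 2, which needs n >= 3. *)
Let transp_braid i :
  transp i * transp (ordS i) * transp i =
    transp (ordS i) * transp i * transp (ordS i).
Proof.
have conj s t : transp s * transp t * transp s = transp t ^ transp s.
  by rewrite conjgE tpermV mulgA.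
rewrite !conj !tpermJ /transp tpermL tpermR !tpermD //;
  by rewrite ?ordS_neq ?ordSS_neq // eq_sym ?ordS_neq ?ordSS_neq.
Qed.

Let transp_word w : 'S_n := \prod_(i <- w) transp i.

Let transp_word_eq u v : cox_eq m u v -> transp_word u = transp_word v.
Proof.
elim=> {u v} // [u w v _ -> //|u v s t].
rewrite /transp_word !big_cat /=; congr (_ * _); rewrite -[RHS]mul1g;
  congr (_ * _).
have alt k : \prod_(i <- flatten (nseq k [:: s; t])) transp i
   = (transp s * transp t) ^+ k.
  elim: k => [|k IHk]; first by rewrite big_nil.
  by rewrite expgS -IHk /= !big_cons mulgA.
rewrite alt /= /affineA_m; case: eqVneq => [<-|neq_st];
  first by rewrite expg1 transp2.
case: ifP => [|/norP[ts st]].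
  have braid i : (transp i * transp (ordS i)) ^+ 3 = 1.
    have transpK j g : transp j * (transp j * g) = g.
      by rewrite mulgA transp2 mul1g.
    transitivity (transp i * transp (ordS i) * transp i *
        (transp (ordS i) * transp i * transp (ordS i))).
      by rewrite expgS expg2 !mulgA.
    by rewrite transp_braid -!mulgA !transpK transp2.
  case/orP=> /eqP->; rewrite ?braid //.
  by apply: invg_inj; rewrite -expVgn invMg !tpermV braid invg1.
have comm_st : transp s * transp t = transp t * transp s.
  apply/commgP/conjg_fixP; rewrite tpermJ !tpermD // 1?eq_sym //.
  by rewrite (inj_eq (can_inj (@ordSK n))).
rewrite expg2 {1}comm_st -mulgA (mulgA (transp s)) transp2 mul1g.
exact: transp2.
Qed.

Let transp_gen s t : cox_gen m s = cox_gen m t -> transp s = transp t.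
Proof.
by move/cox_classP/transp_word_eq; rewrite /transp_word !big_seq1.
Qed.

(** Distinctness and non-commutation of the generators are not visible on
    the presentation; they are read off from the permutations of the cycle
    given by adjacent transpositions. *)
Lemma affineA_gen_inj : injective (cox_gen m).
Proof.
move=> s t /transp_gen /(congr1 (fun f : 'S_n => f s)); rewrite tpermL.
case: tpermP => [-> //|-> /eqP|_ _ /eqP]; first by rewrite ordSS_neq.
by rewrite ordS_neq.
Qed.

Lemma affineA_gen_noncomm s t :
  m s t = 3%N -> cox_gen m s * cox_gen m t <> cox_gen m t * cox_gen m s.
Proof.
wlog -> : s t / t = ordS s.
  move=> IH mst; case: (affineA_m3 mst) => [ts|st]; first exact: IH.
  by move/esym; apply: IH; rewrite // cox_m_sym.
move=> _; rewrite /cox_gen -!cls_cat => /cox_classP/transp_word_eq.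
rewrite /transp_word !big_cons big_nil !mulg1.
move=> /(congr1 (fun f : 'S_n => f s)); rewrite /transp !permM !tpermL.
rewrite (@tpermD _ (ordS s) _ s) ?ordS_neq ?ordSS_neq // tpermL.
by move/eqP; rewrite ordS_neq.
Qed.

End CyclicTranspositions.

Definition affine_fc_word := @fc_word_fully_commutative _ m
  affineA_simply_laced affineA_gen_inj affineA_gen_noncomm.

(** Neighbouring letters are the ones that do not commute, so these subwords
    determine a word up to commutations. *)
Definition edge i w := [seq x <- w | (x == i) || (x == ordS i)].
Notation distinct := (fun x y : 'I_n => x != y).
Definition alternating w := forall i, sorted distinct (edge i w).

Lemma edge_cat i u v : edge i (u ++ v) = edge i u ++ edge i v.
Proof. exact: filter_cat. Qed.

Lemma count_edge i w : count_mem i (edge i w) = count_mem i w.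
Proof.
by rewrite count_filter; apply: eq_count => x /=; case: eqP.
Qed.
Lemma count_edgeS i w : count_mem (ordS i) (edge i w) = count_mem (ordS i) w.
Proof.
by rewrite count_filter; apply: eq_count => x /=; case: eqP => //= ->;
  rewrite orbT.
Qed.

Lemma comm_edge u v i : commutation_eq m u v -> edge i u = edge i v.
Proof.
elim=> {u v} // u v s t w mst _ <-; rewrite !edge_cat; congr (_ ++ (_ ++ _)).
move: mst; rewrite affineA_mE /edge /=.
have [//|neq_st] := eqVneq s t; case: ifP => // /norP[ts st] _.
have [si|si] := eqVneq s i; have [ti|ti] := eqVneq t i => //=.
- by rewrite si ti eqxx in neq_st.
- by rewrite -si (negbTE ts).
- by rewrite -ti (negbTE st).
have [sS|] := eqVneq s; have [tS|] := eqVneq t => //.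
by rewrite sS tS eqxx in neq_st.
Qed.

(** In v, nothing that precedes the first occurrence of s fails to commute
    with s: otherwise some edge subword of v would not start with s, unlike
    that of u. *)
Lemma edge_comm u v : (forall i, edge i u = edge i v) -> commutation_eq m u v.
Proof.
elim: u v => [|s u IHu] v uv.
  case: v uv => [|x v] uv; first exact: CommRefl.
  by have := uv x; rewrite /edge /= eqxx.
have : s \in edge s v by rewrite -uv mem_filter eqxx mem_head.
rewrite mem_filter => /andP[_ sv].
have [v1 [v2 [vE sv1]]] := split_first sv.
have v1s t : t \in v1 -> m t s = 2%N.
  move=> tv1; have neq_ts : t != s by apply: contraNneq sv1 => <-.
  have head_edge i : (s == i) || (s == ordS i) -> (t == i) || (t == ordS i) ->
    False.
    move=> si ti; have := uv i; rewrite vE edge_cat /edge /= si.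
    case e : [seq _ <- v1 | _] => [|x v1'] /=.
      have : t \in [seq x <- v1 | (x == i) || (x == ordS i)].
        by rewrite mem_filter ti.
      by rewrite e.
    case=> sx _; have : s \in [seq x <- v1 | (x == i) || (x == ordS i)].
      by rewrite e sx mem_head.
    by rewrite mem_filter (negbTE sv1) andbF.
  rewrite affineA_mE (negbTE neq_ts); case: ifP => // /orP[] /eqP e.
    by case: (head_edge t); rewrite ?e ?eqxx ?orbT.
  by case: (head_edge s); rewrite ?e ?eqxx ?orbT.
have v_s : commutation_eq m (s :: v1 ++ v2) v.
  have := comm_cat [::] v2 (@comm_past _ m s v1 _); rewrite vE -!catA; apply.
  by move=> t /v1s; rewrite cox_m_sym.
apply: (comm_trans _ v_s); apply: comm_cons; apply: IHu => i.
have := uv i; rewrite -(comm_edge i v_s) /edge /=.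
by case: ifP => // _ [].
Qed.

(** Commutations preserve the edge subwords. A square s s survives in any
    edge subword containing s; a braid s t s becomes a square on the edge
    joining s to its other neighbour, which differs from t as n >= 3. *)
Lemma alternating_fc w : alternating w -> fc_word m w.
Proof.
move=> alt v wv.
have alt_v i : sorted distinct (edge i v) by rewrite -(comm_edge i wv).
have square i x s y : edge i v <> x ++ s :: s :: y.
  by move=> e; have := alt_v i; rewrite e => /cat_sorted2[_] /=; rewrite eqxx.
split=> [x s y e | x s t y /affineA_m3 st e].
  by apply: (square s (edge s x) s (edge s y));
    rewrite e edge_cat /edge /= eqxx.
have [ts|st'] := st.
  have [j sj] : exists j, s = ordS j by exists (ord_pred s); rewrite ord_predK.
  apply: (square j (edge j x) s (edge j y)).
  by rewrite e edge_cat /edge /= ts sj eqxx ordSS_neq !ordS_neq !orbT.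
apply: (square s (edge s x) s (edge s y)).
by rewrite e edge_cat /edge /= eqxx st' !(eq_sym t) ordS_neq ordSS_neq.
Qed.

(** Between two consecutive occurrences of s both neighbours appear.
    Induction on the gap: if p is missing, the other neighbour p' occurs not
    at all (then the gap is a square up to commutations), once (a braid), or
    twice; in the last case two consecutive occurrences of p' enclose a
    smaller gap that misses its neighbour s. *)
Lemma fc_word_gap x s y z : fc_word m (x ++ s :: y ++ s :: z) -> s \notin y ->
  ordS s \in y /\ ord_pred s \in y.
Proof.
have [k] := ubnP (size y); elim: k x s y z => // k IHk x s y z y_lt fc sy.
have nbr p : (p == ordS s) || (p == ord_pred s) =
  (p == ordS s) || (s == ordS p).
  by congr (_ || _); rewrite -(inj_eq (can_inj (@ordSK n))) ord_predK eq_sym.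
suff both p p' : p != p' -> (p == ordS s) || (p == ord_pred s) ->
    (p' == ordS s) || (p' == ord_pred s) -> p \notin y -> False.
  have neq : ordS s != ord_pred s.
    by apply/eqP => e; have := ordSS_neq (ord_pred s); rewrite ord_predK e eqxx.
  split; apply/negPn/negP => out; [apply: (both (ordS s) (ord_pred s)) |
    apply: (both (ord_pred s) (ordS s))]; rewrite ?eqxx ?orbT // eq_sym //.
move=> neq_pp' ps p's py.
have neighbours t : (t == ordS s) || (t == ord_pred s) -> t = p \/ t = p'.
  move: neq_pp'; case/orP: ps => /eqP->; case/orP: p's => /eqP->;
    by rewrite ?eqxx // => _ /orP[] /eqP; auto.
have commute y' : {subset y' <= y} -> p' \notin y' -> forall t, t \in y' ->
  m s t = 2%N.
  move=> y'y p'y' t ty'; rewrite affineA_mE.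
  have [e|neq_st] := eqVneq s t; first by rewrite e y'y in sy.
  rewrite -nbr; case: ifP => // /neighbours[] e; rewrite e in ty'.
    by rewrite (y'y _ ty') in py.
  by rewrite ty' in p'y'.
have [/split_first[y1 [r [yE p'y1]]] | p'y] := boolP (p' \in y); last first.
  have := fc_word_comm (comm_cat x (s :: z) (comm_past (commute y _ p'y))).
  rewrite -!catA => /(_ (fun _ H => H)) /(_ fc) /(_ _ (comm_refl _ _)) [].
  by move=> /(_ (x ++ y) s z); rewrite -!catA.
have [/split_first[y2 [y3 [rE p'y2]]] | p'r] := boolP (p' \in r).
  have [||s1 s2] := IHk (x ++ s :: y1) p' y2 (y3 ++ s :: z) _ _ p'y2.
  - by move: y_lt; rewrite yE rE !size_cat /= !size_cat /=; lia.
  - by move: fc; rewrite yE rE -!catA /= -!catA.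
  have sy2 : s \notin y2.
    by apply: contra sy => sy2; rewrite yE rE !mem_cat !inE mem_cat sy2 !orbT.
  move: p's; rewrite nbr => /orP[] /eqP e; last by rewrite e s1 in sy2.
  by rewrite e ordSK in s2; rewrite s2 in sy2.
have com1 := comm_past (commute y1 _ p'y1);
  have com2 := comm_past (commute r _ p'r).
have w_braid : commutation_eq m (x ++ s :: y ++ s :: z)
    (x ++ y1 ++ [:: s; p'; s] ++ r ++ z).
  rewrite yE.
  apply: (@comm_trans _ _ (x ++ (y1 ++ [:: s]) ++ p' :: r ++ s :: z)).
    have := comm_cat x (p' :: r ++ s :: z) (com1 _); rewrite -!catA; apply.
    by move=> t ty1; rewrite yE mem_cat ty1.
  have := comm_cat (x ++ y1 ++ [:: s; p']) z (comm_sym (com2 _)).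
  rewrite -!catA /= => com; apply: com => t tr.
  by rewrite yE mem_cat inE tr !orbT.
have [_ /(_ (x ++ y1) s p' (r ++ z))] := fc _ w_braid.
rewrite -!catA; apply => //; rewrite affineA_mE.
have -> : (s == p') = false.
  by apply/negP => /eqP e; move: p's; rewrite nbr e eq_sym ordS_neq.
by rewrite -nbr p's.
Qed.

Lemma fc_alternating w : fc_word m w -> alternating w.
Proof.
move=> fc i; elim: w fc => // s w IHw fc.
have {}IHw := IHw (@fc_word_catr _ _ [:: s] _ fc).
rewrite /edge /=; case: ifP => // si; rewrite -/(edge i w).
case e : (edge i w) => [|s' f] //=;
  rewrite -[path _ _ _]/(sorted distinct (s' :: f)).
rewrite -e IHw andbT; apply/negP => /eqP ss'; rewrite -{s'}ss' in e.
have sw : s \in w.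
  have : s \in edge i w by rewrite e mem_head.
  by rewrite mem_filter => /andP[].
have [y [z [wE sy]]] := split_first sw.
have [Sy Py] : ordS s \in y /\ ord_pred s \in y.
  by apply: (@fc_word_gap [::] s y z) => //; rewrite -wE.
have edge_y t : t \in y -> (t == i) || (t == ordS i) -> False.
  move=> ty ti; have : t \in edge i y by rewrite mem_filter ti.
  move: e; rewrite wE edge_cat; case ey : (edge i y) => [|s' g] //= [s's _].
  have : s' \in edge i y by rewrite ey mem_head.
  by rewrite s's mem_filter (negbTE sy) andbF.
case/orP: si => /eqP si; first by apply: (edge_y _ Sy); rewrite si eqxx orbT.
by apply: (edge_y _ Py); rewrite si ordSK eqxx.
Qed.

End AffineA.

(** * Words with prescribed edge projections *)

Section Altseq.
Variable T : eqType.
Implicit Types (x y : T) (p : seq T).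

Fixpoint altseq x y k := if k is k'.+1 then x :: altseq y x k' else [::].

Lemma count_altseq x y k : x != y ->
  count_mem x (altseq x y k) = uphalf k /\ count_mem y (altseq x y k) = half k.
Proof.
elim: k x y => // k IHk x y xy /=; rewrite eqxx (negbTE xy).
have [|-> ->] := IHk y x; first by rewrite eq_sym.
by rewrite uphalfE.
Qed.

Lemma sorted_altseq x y k : x != y -> sorted (fun a b => a != b) (altseq x y k).
Proof.
elim: k x y => // -[|k] IHk x y xy //.
by have := IHk y x; rewrite /= xy eq_sym => ->.
Qed.

Lemma altseq_sub x y k : {subset altseq x y k <= [:: x; y]}.
Proof.
elim: k x y => // k IHk x y z; rewrite /= !inE => /orP[-> //|/IHk].
by rewrite !inE orbC.
Qed.

Lemma sorted_altseqE x y p : {subset p <= [:: x; y]} ->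
  sorted (fun a b => a != b) p -> head x p = x -> p = altseq x y (size p).
Proof.
elim: p x y => //= z p IHp x y sub path_p zx; rewrite {z}zx in sub path_p *.
congr (_ :: _); apply: IHp; last 1 first.
- case: p path_p sub => //= z p /andP[xz _] /(_ z).
  by rewrite !inE eqxx orbT eq_sym (negbTE xz) => /(_ isT) /eqP.
- by move=> z zp; have := sub z; rewrite !inE zp orbT orbC => ->.
exact: path_sorted path_p.
Qed.

End Altseq.

Section CyclicWalks.
Variable n : nat.
Hypothesis n_ge3 : (3 <= n)%N.
Notation m := (affineA n).
Implicit Types (i j s t : 'I_n) (u v w : seq 'I_n).
Notation distinct := (fun x y : 'I_n => x != y).

Lemma iter_ordS k i : iter k (@ordS n) i = ((i + k) %% n)%N :> nat.
Proof.
elim: k => [|k IHk]; first by rewrite addn0 modn_small.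
by rewrite /= IHk -addn1 modnDml addn1 addnS.
Qed.

Lemma cyclic_ind (Q : 'I_n -> Prop) i :
  (forall j, Q j -> Q (ordS j)) -> Q i -> forall j, Q j.
Proof.
move=> QS Qi j; have -> : j = iter (j + (n - i)) (@ordS n) i.
  apply: ord_inj; rewrite iter_ordS addnCA subnKC 1?ltnW //.
  by rewrite modnDr modn_small.
by elim: (_ + _)%N => //= k; apply: QS.
Qed.

(** The necessary conditions on the edge subwords of an alternating word:
    each letter occurs equally often in the two subwords that contain it. *)
Definition edge_family (p : 'I_n -> seq 'I_n) :=
  [/\ forall i, sorted distinct (p i),
      forall i, {subset p i <= [:: i; ordS i]} &
      forall i, count_mem (ordS i) (p i) = count_mem (ordS i) (p (ordS i))].

(** A letter that comes first in both of its edge subwords. Without one, as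
    soon as some edge subword starts with its right letter so does the next
    one, all around the cycle; and if none does, the starting letters are
    all left ones, propagating in the other direction. *)
Lemma edge_family_source p : edge_family p ->
  ~ (forall i, ohead (p i) = Some i) ->
  ~ (forall i, ohead (p i) = Some (ordS i)) ->
  (exists i, p i <> [::]) ->
  exists j, ohead (p j) = Some (ordS j) /\ ohead (p (ordS j)) = Some (ordS j).
Proof.
move=> [_ sub cons] not_left not_right [i0 pi0].
have headP i : [\/ p i = [::], ohead (p i) = Some i | ohead (p i) =
  Some (ordS i)].
  case e : (p i) => [|x q]; first by constructor 1.
  have := sub i x; rewrite e !inE eqxx => /(_ isT) /orP[]/eqP -> /=;
  by [constructor 2 | constructor 3].
have head_mem i x : ohead (p i) = Some x -> x \in p i.
  by case: (p i) => //= y q [->]; rewrite mem_head.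
have consE i : (ordS i \in p i) = (ordS i \in p (ordS i)).
  by rewrite -!has_pred1 !has_count cons.
apply: contrapT => no_source.
have rightS i : ohead (p i) = Some (ordS i) -> ohead (p (ordS i)) =
  Some (ordS (ordS i)).
  move=> hi; have := head_mem _ _ hi; rewrite consE.
  case: (headP (ordS i)) => // [-> //|hSi _].
  by case: no_source; exists i.
have no_right i : ohead (p i) <> Some (ordS i).
  move=> hi; apply: not_right.
  exact: (cyclic_ind (Q := fun i => ohead (p i) = Some (ordS i)) rightS hi).
have leftS i : ohead (p i) <> Some i -> ohead (p (ordS i)) <> Some (ordS i).
  move=> hi /head_mem; rewrite -consE.
  by case: (headP i) => // [->|]; last by move/no_right.
apply: not_left => i; apply: contrapT => hi.
have := cyclic_ind (Q := fun i => ohead (p i) <> Some i) leftS hi i0.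
by case: (headP i0) => // /no_right.
Qed.

(** Take a letter that comes first in both of its edge subwords and remove
    it. The remaining family cannot start uniformly, for then the removed
    letter would have been doubled; so the construction continues. *)
Lemma edge_family_realize p : edge_family p ->
  ~ (forall i, ohead (p i) = Some i) ->
  ~ (forall i, ohead (p i) = Some (ordS i)) ->
  exists w, forall i, edge i w = p i.
Proof.
have [k] := ubnP (\sum_i size (p i))%N;
  elim: k p => // k IHk p lt_k fam notL notR.
have [empty | nonempty] := pselect (forall i, p i = [::]).
  by exists [::] => i; rewrite empty.
have [j [hj hSj]] : exists j,
    ohead (p j) = Some (ordS j) /\ ohead (p (ordS j)) = Some (ordS j).
  apply: edge_family_source => //.
  by apply: contrapT => none; apply: nonempty => i; apply: contrapT => pi;
    apply: none; exists i.
set s := ordS j in hj hSj.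
pose touches i := (s == i) || (s == ordS i).
have touchesE i : touches i -> i = s \/ i = j.
  case/orP=> /eqP e; first by left.
  by right; apply: (can_inj (@ordSK n)); rewrite -e.
have phd i : touches i -> p i = s :: behead (p i).
  by case/touchesE=> ->; [case: (p s) hSj | case: (p j) hj] => //= z q [->].
pose p' i := if touches i then behead (p i) else p i.
have ts : touches s by rewrite /touches eqxx.
have tj : touches j by rewrite /touches eqxx orbT.
have pE i : p i = if touches i then s :: p' i else p' i.
  by rewrite /p'; case ti: (touches i); rewrite -?phd.
case: fam => sorted_p sub_p cons_p.
have count_p i x : count_mem x (p i) =
  (touches i && (s == x) + count_mem x (p' i))%N.
  by rewrite {1}pE; case: (touches i).
have fam' : edge_family p'.
  split=> i.
  - have := sorted_p i; rewrite pE; case: ifP => // _ /=; exact: path_sorted.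
  - by move=> x xp; apply: sub_p; rewrite pE; case: ifP => // _;
    rewrite inE xp orbT.
  have := cons_p i; rewrite !count_p.
  have -> : touches i && (s == ordS i) = touches (ordS i) && (s == ordS i).
    by case: eqP => [e|]; rewrite ?andbF // /touches e !eqxx !orbT.
  exact: addnI.
have not_head i : touches i -> ohead (p' i) <> Some s.
  move=> ti; have := sorted_p i; rewrite pE ti.
  by case: (p' i) => //= z q /andP[sz _] [zs]; rewrite zs eqxx in sz.
have [|||w wE] := IHk p' _ fam'.
- apply: (@leq_trans (\sum_i size (p i))%N); last by rewrite -ltnS.
  rewrite (bigD1 s) //= [X in (_ < X)%N](bigD1 s) //=.
  rewrite [p s]pE ts /= addSn ltnS leq_add2l; apply: leq_sum => i _.
  by rewrite [p i]pE; case: ifP.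
- by move=> h; apply: (not_head s).
- by move=> h; apply: (not_head j).
exists (s :: w) => i; rewrite pE -wE /edge /= -/(touches i).
by case: ifP.
Qed.

(** The step between heights i and i + 1: an alternating word on the letters
    i and i + 1 is known from the two letter counts, except that if they are
    equal and positive one must record which letter comes first. *)
Definition edge_step i w : step :=
  let a := count_mem i w in let b := count_mem (ordS i) w in
  if (a < b)%N then Up else if (b < a)%N then Down
  else if head i (edge i w) == i then FlatL else FlatR.

(** Inverse of edge_step: the alternating word of a step that starts at
    height a. *)
Definition edge_word i a (st : step) : seq 'I_n :=
  match st with
  | Up => altseq (ordS i) i (a + a.+1)
  | Down => altseq i (ordS i) (a + a.-1)
  | FlatL => altseq i (ordS i) (a + a)
  | FlatR => altseq (ordS i) i (a + a)
  end%N.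

Lemma edge_sub i w : {subset edge i w <= [:: i; ordS i]}.
Proof. by move=> x; rewrite mem_filter !inE => /andP[]. Qed.

Lemma edge_stepP w i : alternating w ->
  [/\ edge i w = edge_word i (count_mem i w) (edge_step i w),
      is_step (count_mem i w) (edge_step i w) (count_mem (ordS i) w) &
      count_mem i w = 0%N -> edge_step i w <> FlatR].
Proof.
move=> /(_ i) sorted_w; have Si : i != ordS i by rewrite eq_sym ordS_neq.
have Si' : ordS i != i by rewrite ordS_neq.
rewrite /edge_step -count_edge -count_edgeS.
have [hi|hi] := eqVneq (head i (edge i w)) i.
  have := sorted_altseqE (@edge_sub i w) sorted_w hi.
  move: (size _) => k e; rewrite e; have [-> ->] := count_altseq k Si.
  have := odd_double_half k; rewrite uphalf_half; case: (odd k) => /= kE.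
    rewrite add1n ltnNge leqnSn ltnSn; split; [ | exact: eqxx | by []].
    by congr (altseq _ _ _); lia.
  rewrite add0n ltnn; split; [ | exact: eqxx | by []].
  by congr (altseq _ _ _); lia.
have hS : head (ordS i) (edge i w) = ordS i.
  case: (edge i w) (@edge_sub i w) hi => //= x q /(_ x); rewrite !inE eqxx.
  by move=> /(_ isT) /orP[]/eqP -> //; rewrite eqxx.
have sub' : {subset edge i w <= [:: ordS i; i]}.
  by move=> x /edge_sub; rewrite !inE orbC.
have := sorted_altseqE sub' sorted_w hS; move: hi.
case: (posnP (size (edge i w))) => [/size0nil-> /=|]; first by rewrite eqxx.
move: (size _) => k k_gt0 hi e; rewrite e; have [-> ->] := count_altseq k Si'.
have := odd_double_half k; rewrite uphalf_half; case: (odd k) => /= kE.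
  rewrite add1n ltnSn; split; [ | exact: eqxx | by []].
  by congr (altseq _ _ _); lia.
rewrite add0n ltnn; split; [ | exact: eqxx | by move=> k0; move: k_gt0;
  rewrite -kE k0].
by congr (altseq _ _ _); lia.
Qed.

End CyclicWalks.

(** * Fully commutative elements as walks *)

Section WordWalks.
Variable n : nat.
Hypothesis n_ge3 : (3 <= n)%N.
Notation m := (affineA n).
Implicit Types (i j s t : 'I_n) (u v w : seq 'I_n).

Let n_gt0 : (0 < n)%N. Proof. exact: leq_trans n_ge3. Qed.

Lemma edge_word_count i a st b : is_step a st b ->
  count_mem i (edge_word i a st) = a /\ count_mem (ordS i) (edge_word i a st) =
    b.
Proof.
have Si : i != ordS i by rewrite eq_sym ordS_neq.
have Si' : ordS i != i by rewrite ordS_neq.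
have even c : (c + c)%N = c.*2 by rewrite addnn.
case: st => /eqP bE; rewrite /edge_word.
- have [-> ->] := count_altseq (a + a.+1) Si'.
  by rewrite bE addnS even /= uphalf_double doubleK.
- have [-> ->] := count_altseq (a + a.-1) Si.
  by rewrite bE [(b.+1 + _)%N]addSn even /= uphalf_double doubleK.
- have [-> ->] := count_altseq (a + a) Si.
  by rewrite bE even uphalf_double doubleK.
have [-> ->] := count_altseq (a + a) Si'.
by rewrite bE even uphalf_double doubleK.
Qed.

(** Height n of a closed walk is height 0, hence indices modulo n. *)
Definition wrap k : 'I_n := Ordinal (ltn_pmod k n_gt0).

Lemma wrap_ord i : wrap i = i.
Proof. by apply: ord_inj; rewrite /= modn_small. Qed.
Lemma wrapS i : wrap i.+1 = ordS i. Proof. exact: ord_inj. Qed.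
Lemma wrapn : wrap n = wrap 0.
Proof. by apply: ord_inj; rewrite /= modnn mod0n. Qed.

Definition word_walk w : prewalk n :=
  ([tuple count_mem (wrap k) w | k < n.+1], [tuple edge_step i w | i < n]).

Lemma height_word_walk w k : (k <= n)%N ->
  height (word_walk w) k = count_mem (wrap k) w.
Proof.
rewrite -ltnS => k_lt; rewrite /height -[k]/(nat_of_ord (Ordinal k_lt)).
by rewrite -(tnth_nth 0%N) tnth_mktuple.
Qed.

Lemma wtO_word_walk w : wtO (word_walk w) = size w.
Proof.
transitivity (\sum_i count_mem i w)%N.
  by apply: eq_bigr => i _; rewrite height_word_walk ?wrap_ord // ltnW.
elim: w => [|s w IHw] /=; first by rewrite big1.
rewrite big_split /= IHw (bigD1 s) //= eqxx big1 // => i.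
by rewrite eq_sym => /negbTE->.
Qed.

Lemma word_walk_edge u v : (forall i, edge i u = edge i v) ->
  word_walk u = word_walk v.
Proof.
move=> uv; have count_uv i : count_mem i u = count_mem i v.
  by rewrite -count_edge uv count_edge.
rewrite /word_walk; congr pair; apply: eq_from_tnth => k;
  rewrite !tnth_mktuple //.
by rewrite /edge_step uv !count_uv.
Qed.

Lemma word_walk_inj u v : alternating u -> alternating v ->
  word_walk u = word_walk v -> forall i, edge i u = edge i v.
Proof.
move=> alt_u alt_v uv i.
have [-> _ _] := edge_stepP n_ge3 i alt_u;
  have [-> _ _] := edge_stepP n_ge3 i alt_v.
have := congr1 (fun P => height P i) uv;
  rewrite /= !height_word_walk ?wrap_ord 1?ltnW //.
have := congr1 (fun P : prewalk n => tnth P.2 i) uv; rewrite /= !tnth_mktuple.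
by move=> -> ->.
Qed.

Lemma word_walkOstar w : alternating w -> walkOstar (word_walk w).
Proof.
move=> alt_w; split; first split.
- move=> i; have i_le : (i <= n)%N by apply: ltnW.
  rewrite !height_word_walk // wrap_ord wrapS /word_walk /= tnth_mktuple.
  by have [] := edge_stepP n_ge3 i alt_w.
- by rewrite !height_word_walk // wrapn.
move=> i; have i_le : (i <= n)%N by apply: ltnW.
rewrite height_word_walk // wrap_ord /word_walk /= tnth_mktuple.
by have [] := edge_stepP n_ge3 i alt_w.
Qed.

(** The first letter of a word starts both edge subwords that contain it, so
    these cannot all start on the same side. *)
Lemma word_walk_spiral w l : alternating w -> l = FlatL \/ l = FlatR ->
  ~ spiral l (word_walk w).
Proof.
move=> alt_w ll [h h_gt0 wE].
have count_h i : count_mem i w = h.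
  have := congr1 (fun P => height P i) wE;
    have i_le : (i <= n)%N by apply: ltnW.
  by rewrite /= height_word_walk ?wrap_ord // height_walk_of // take_nseq //
    foldl_flat.
have step_l i : edge_step i w = l.
  have := congr1 (fun P : prewalk n => tnth P.2 i) wE.
  by rewrite /= tnth_mktuple => ->; rewrite (tnth_nth l) /= nth_nseq ltn_ord.
have edge_h i : edge i w = edge_word i h l.
  by have [-> _ _] := edge_stepP n_ge3 i alt_w; rewrite count_h step_l.
case: w count_h edge_h {wE alt_w step_l} => [|s w] count_h edge_h.
  by move: h_gt0; rewrite -(count_h (wrap 0)).
case: h h_gt0 edge_h {count_h} => // h _ edge_h.
case: ll edge_h => -> edge_h.
  have := edge_h (ord_pred s); rewrite /edge /= ord_predK eqxx orbT.
  by case=> /eqP; rewrite -{1}[s]ord_predK ordS_neq.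
have := edge_h s; rewrite /edge /= eqxx.
by case=> /eqP; rewrite eq_sym ordS_neq.
Qed.

Lemma cyclic_nonincreasing_const (h : 'I_n -> nat) :
  (forall i, (h (ordS i) <= h i)%N) ->
  forall i j, h i = h j.
Proof.
move=> hS; have le i j : (h j <= h i)%N.
  apply: (cyclic_ind (Q := fun j => (h j <= h i)%N) (i := i)) => // k.
  exact: leq_trans (hS k).
by move=> j k; apply/eqP; rewrite eqn_leq !le.
Qed.

Lemma cyclic_nondecreasing_const (h : 'I_n -> nat) :
  (forall i, (h i <= h (ordS i))%N) ->
  forall i j, h i = h j.
Proof.
move=> hS; have le i j : (h i <= h j)%N.
  apply: (cyclic_ind (Q := fun j => (h i <= h j)%N) (i := i)) => // k hk.
  exact: leq_trans hk (hS k).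
by move=> j k; apply/eqP; rewrite eqn_leq !le.
Qed.

(** If all edge subwords start on the same side, the heights are monotone
    around the cycle, hence constant, and the walk is a spiral. *)
Lemma word_walk_surj P : walkOstar P -> ~ spiral FlatL P -> ~ spiral FlatR P ->
  exists2 w, alternating w & word_walk w = P.
Proof.
move=> [[walkP h0n] star] notL notR.
have hS i : height P i.+1 = height P (ordS i).
  rewrite val_ordS; case: ltnP => // i_ge.
  by rewrite h0n (_ : i.+1 = n) //; have := ltn_ord i; lia.
have stepP i : is_step (height P i) (tnth P.2 i) (height P (ordS i)).
  by rewrite -hS; apply: walkP.
have spiralP l : (forall i j, height P (i : 'I_n) = height P (j : 'I_n)) ->
    (0 < height P (wrap 0))%N -> (forall i, tnth P.2 i = l) -> spiral l P.
  move=> const h_gt0 all_l; exists (height P 0).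
    by move: h_gt0; rewrite /= mod0n.
  rewrite {1}(walkE walkP); congr walk_of; apply: eq_from_tnth => i.
  by rewrite all_l (tnth_nth l) /= nth_nseq ltn_ord.
pose p i := edge_word i (height P i) (tnth P.2 i).
have Si i : i != ordS i by rewrite eq_sym ordS_neq.
have Si' i : ordS i != i by rewrite ordS_neq.
have fam : edge_family p.
  split=> i.
  - by rewrite /p; case: (tnth _ _) => /=; apply: sorted_altseq.
  - by rewrite /p; case: (tnth _ _) => /= x /altseq_sub; rewrite // !inE orbC.
  have [_ ->] := edge_word_count i (stepP i).
  by have [-> _] := edge_word_count (ordS i) (stepP (ordS i)).
have ohead_altseq (x y z : 'I_n) k :
    ohead (altseq x y k) = Some z -> x = z /\ (0 < k)%N.
  by case: k => //= k [].
have p_left i : ohead (p i) = Some i ->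
    (height P (ordS i) <= height P i)%N /\ (0 < height P i)%N.
  rewrite /p; have := stepP i; case: (tnth _ _) => /eqP -> /ohead_altseq[e];
    try by case/eqP: (Si' i).
  - by rewrite leqnSn.
  - by rewrite leqnn addn_gt0 orbb.
have p_right i : ohead (p i) = Some (ordS i) ->
    (height P i <= height P (ordS i))%N /\ (0 < height P (ordS i))%N.
  rewrite /p; have := stepP i; case: (tnth _ _) => /eqP -> /ohead_altseq[e];
    try by case/eqP: (Si i).
  - by rewrite leqnSn.
  - by rewrite leqnn addn_gt0 orbb.
have notL' : ~ (forall i, ohead (p i) = Some i).
  move=> left; apply: notL.
  have const : forall i j, height P i = height P j.
    by apply: (@cyclic_nonincreasing_const (fun i => height P i)) => i;
      have [] := p_left i (left i).
  apply: spiralP => // [|i]; first by have [] := p_left _ (left (wrap 0)).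
  have := left i; rewrite /p; have := stepP i; rewrite (const (ordS i) i).
  case: (tnth _ _) => //= /eqP e; try lia.
  by case/ohead_altseq=> e'; case/eqP: (Si' i).
have notR' : ~ (forall i, ohead (p i) = Some (ordS i)).
  move=> right; apply: notR.
  have const : forall i j, height P i = height P j.
    by apply: (@cyclic_nondecreasing_const (fun i => height P i)) => i;
      have [] := p_right i (right i).
  apply: spiralP => // [|i].
    by have [_] := p_right _ (right (wrap 0)); rewrite (const _ (wrap 0)).
  have := right i; rewrite /p; have := stepP i; rewrite (const (ordS i) i).
  case: (tnth _ _) => //= /eqP e; try lia.
  by case/ohead_altseq=> e'; case/eqP: (Si i).
have [w wE] := edge_family_realize fam notL' notR'.
have count_w i : count_mem i w = height P i.
  by rewrite -count_edge wE; have [->] := edge_word_count i (stepP i).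
exists w; first by move=> i; rewrite wE; case: fam.
apply: (@eq_trans _ _ (P.1, P.2)); last by case: (P).
rewrite /word_walk; congr pair; apply: eq_from_tnth => k; rewrite !tnth_mktuple.
  rewrite (tnth_nth 0%N) -/(height P k) count_w /=.
  have := ltn_ord k; rewrite ltnS leq_eqVlt => /orP[/eqP->|k_lt].
    by rewrite modnn h0n.
  by rewrite modn_small.
rewrite /edge_step wE /p !count_w; have := stepP k; have := star k.
case: (tnth _ _) => /= h0 /eqP e.
- by rewrite e ltnSn.
- by rewrite e ltnNge leqnSn ltnSn.
- by rewrite e ltnn; case: (_ + _)%N => [|c] /=; rewrite eqxx.
rewrite e ltnn; have : height P k != 0%N by apply/eqP => /h0.
by case: (height P k) => // c _; rewrite /= ordS_neq.
Qed.

Local Open Scope classical_set_scope.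

(** Each fully commutative element is sent to the walk of a chosen reduced
    word; another reduced word has the same edge subwords. *)
Lemma affineA_FC_walks : affineA_FC n =
  genfun [set P : prewalk n |
    [/\ walkOstar P, ~ spiral FlatL P & ~ spiral FlatR P]] (@wtO n).
Proof.
have [word wordP] := choice (@reduced_expression_exists _ m).
have alt_word g : @fully_commutative _ m g -> alternating (word g).
  by move/(fully_commutative_fc_word (wordP g))/(fc_alternating n_ge3).
rewrite /affineA_FC -[LHS]mul1r -(expr0 fpsX); apply/esym.
apply: (@genfun_bij _ _ _ _ _ _ (word_walk \o word)) => [k|g h||g _].
- by apply: sub_finite_set (finite_cox_length m k) => g [].
- rewrite !inE => fc_g fc_h /= gh.
  rewrite -(reduced_expression_cls (wordP g)) -(reduced_expression_cls (wordP
    h)).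
  apply: comm_cls; apply: edge_comm => //.
  by apply: word_walk_inj => //; apply: alt_word.
- move=> P; split=> [[OP notL notR] | [g /alt_word alt_g <-]].
    have [w alt_w <-] := word_walk_surj OP notL notR.
    have [w_red fc_w] := affine_fc_word n_ge3 (alternating_fc n_ge3 alt_w).
    exists (cox_class m w) => //=.
    by apply: word_walk_edge => i; apply: comm_edge; apply: fc_w => //.
  by split; [exact: word_walkOstar | apply: word_walk_spiral; auto ..].
by rewrite /= wtO_word_walk addn0; have [] := wordP g.
Qed.

End WordWalks.

Theorem corollary2p4 (n : nat) (n_ge3 : (3 <= n)%N) :
  let q : fps int := fpsX in
  let x : fps (fps int) := fpsX in
  let qc : fps (fps int) := fpsC q in
  let dxM := fps_dilate q (fps_deriv (x * M_gf)) in
  let eq_Mstar (F : fps (fps int)) :=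
    F = 1 + x * F + qc * x * (F - 1) * fps_dilate q F in
  let eq_M (F G : fps (fps int)) := G = F + x * F * G in
  [/\ affineA_FC n = Ostar_ n - (2%:R * q ^+ n) / (1 - q ^+ n),
      Ostar_ n - (2%:R * q ^+ n) / (1 - q ^+ n)
        = (q ^+ n * (Ocheck_ n - 2%:R)) / (1 - q ^+ n) + Ocheckstar_ n,
      Ocheck_gf = M_gf * (1 + qc * x ^+ 2 * dxM),
      Ocheckstar_gf = Mstar_gf * (1 + qc * x ^+ 2 * dxM)
    & [/\ eq_Mstar Mstar_gf, eq_M Mstar_gf M_gf
        & forall F G, eq_Mstar F -> eq_M F G -> F = Mstar_gf /\ G = M_gf]].
Proof.
have n_gt0 : (0 < n)%N by apply: leq_trans n_ge3.
have eqMs := ground_gf_star_eq (fpsX : fps int); rewrite -Mstar_gfE in eqMs.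
have eqM := ground_gf_eq (fpsX : fps int); rewrite -Mstar_gfE -M_gfE in eqM.
split; [ | exact: Ostar_Ocheck | exact: Ocheck_gfE | exact: Ocheckstar_gfE |
  split=> //].
  by rewrite (affineA_FC_walks n_ge3); apply: Ostar_spirals.
move=> F G eqF eqG; have FE := Mstar_unique eqF eqMs.
by split=> //; rewrite FE in eqG; apply: M_unique eqG eqM.
Qed.
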